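(* Let $\gamma^*:[0,1]\to\mathbb{R}^n$ be a computable function (not necessarily one-to-one) such that $\Gamma=\gamma^*([0,1])$ is a simple rectifiable curve. Let $l=\mathcal{H}^1(\Gamma)$, let $O_l$ be any oracle for $l$, i.e. $O_l:\mathbb{N}\to\mathbb{Q}$ with $|O_l(n)-l|\le2^{-n}$ for all $n\in\mathbb{N}$, and let $\gamma$ be a normalized constant-speed parametrization of $\Gamma$. Then $\gamma$ is computable with oracle $O_l$.
   Context: A curve is simple if it is the range of a one-to-one continuous map from a compact interval, and rectifiable if it has finite length; $\mathcal{H}^1$ is one-dimensional Hausdorff measure (equal to length for simple curves). A normalized constant-speed parametrization of a simple rectifiable curve $\Gamma$ of length $L$ is a one-to-one continuous $\gamma:[0,1]\to\mathbb{R}^n$ with range $\Gamma$ such that $\gamma([0,t])$ has length $tL$ for all $0\le t\le1$ (there are exactly two, one in each direction). An oracle for a real $t$ is any $O_t:\mathbb{N}\to\mathbb{Q}$ with $|O_t(s)-t|\le2^{-s}$ for all $s$. A function $f:[0,1]\to\mathbb{R}^n$ is computable if there is an oracle Turing machine $M$ such that for every $t\in[0,1]$, $r\in\mathbb{N}$, and every oracle $O_t$ for $t$, $M^{O_t}(r)$ outputs a rational point within $2^{-r}$ of $f(t)$; it is computable with oracle $O_l$ if the same holds for a machine that additionally has access to $O_l$. *)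

(* Defs.v *)
From HB Require Import structures.
From mathcomp Require Import all_boot all_order all_algebra.
From mathcomp Require Import all_classical all_reals.
From mathcomp Require Import all_analysis.
Set Implicit Arguments. Unset Strict Implicit. Unset Printing Implicit Defensive.
Import Order.TTheory GRing.Theory Num.Theory.
Import numFieldNormedType.Exports.
Local Open Scope classical_set_scope.
Local Open Scope ring_scope.

(* Model of computation: Kleene's partial recursive functions relative *)
(* to a finite list of oracles (functions nat -> nat).  This is the    *)
(* standard equivalent of oracle Turing machines.                      *)

Inductive code : Type :=
| CZero : code
| CSucc : code
| CProj : nat -> code
| COrc  : nat -> code
| CComp : code -> list code -> code
| CPrec : code -> code -> code
| CMu   : code -> code.

(* Missing arguments default to 0; missing oracles to the zero function. *)
Inductive eval (os : seq (nat -> nat)) : code -> seq nat -> nat -> Prop :=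
| ev_zero xs : eval os CZero xs 0
| ev_succ xs : eval os CSucc xs (nth 0 xs 0).+1
| ev_proj i xs : eval os (CProj i) xs (nth 0 xs i)
| ev_orc j xs : eval os (COrc j) xs (nth (fun _ => 0) os j (nth 0 xs 0))
| ev_comp f gs xs ys y :
    evals os gs xs ys -> eval os f ys y -> eval os (CComp f gs) xs y
| ev_prec0 f g xs y :
    head 0 xs = 0 -> eval os f (behead xs) y -> eval os (CPrec f g) xs y
| ev_precS f g k rest z y :
    eval os (CPrec f g) (k :: rest) z -> eval os g (k :: z :: rest) y ->
    eval os (CPrec f g) (k.+1 :: rest) y
| ev_mu f xs y :
    eval os f (y :: xs) 0 ->
    (forall k, (k < y)%N -> exists2 v, v <> 0 & eval os f (k :: xs) v) ->
    eval os (CMu f) xs y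
with evals (os : seq (nat -> nat)) : list code -> seq nat -> seq nat -> Prop :=
| evs_nil xs : evals os nil xs [::]
| evs_cons g gs xs y ys :
    eval os g xs y -> evals os gs xs ys -> evals os (g :: gs) xs (y :: ys).

Definition npair (a b : nat) : nat := (2 ^ a * (b.*2).+1).-1.
Definition nunpair (k : nat) : nat * nat :=
  let a := logn 2 k.+1 in (a, (k.+1 %/ 2 ^ a)./2).

Definition zig (z : int) : nat :=
  match z with Posz m => m.*2 | Negz m => (m.*2).+1 end.
Definition unzig (m : nat) : int :=
  if odd m then - ((m.+1)./2)%:Z else (m./2)%:Z.

Definition encq (q : rat) : nat := npair (zig (numq q)) (absz (denq q)).-1.
Definition decq (k : nat) : rat :=
  let p := nunpair k in (unzig p.1)%:~R / (p.2.+1)%:R.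

Fixpoint decseq (m k : nat) : seq nat :=
  match m with
  | 0 => [::]
  | m'.+1 => (nunpair k).1 :: decseq m' (nunpair k).2
  end.

Definition decpt (n k : nat) : 'rV[rat]_n :=
  \row_(i < n) decq (nth 0 (decseq n k) i).

Section Geometry.
Context {R : realType} {n : nat}.
Local Notation V := 'rV[R]_n.

Definition edist (x y : V) : R :=
  Num.sqrt (\sum_(i < n) (x ord0 i - y ord0 i) ^+ 2).

(* diameter (diam of the empty set is 0) *)
Definition ediam (A : set V) : \bar R :=
  ereal_sup ([set d | exists x y, A x /\ A y /\ d = (edist x y)%:E] `|` [set 0%E]).

Definition H1delta (d : R) (A : set V) : \bar R :=
  ereal_inf [set s | exists E : nat -> set V,
     [/\ A `<=` \bigcup_i E i, (forall i, (ediam (E i) <= d%:E)%E) &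
         s = (\sum_(i <oo) ediam (E i))%E]].

(* one-dimensional Hausdorff measure: lim_{d -> 0+} H1delta d = sup_{d > 0} *)
Definition H1 (A : set V) : \bar R :=
  ereal_sup [set x | exists2 d : R, 0 < d & x = H1delta d A].

Definition simple_curve (G : set V) : Prop :=
  exists (a b : R) (g : R -> V), [/\ a <= b,
     {within `[a, b]%classic, continuous g},
     {in `[a, b]%classic &, injective g} &
     g @` `[a, b]%classic = G].

Definition rectifiable (G : set V) : Prop := (H1 G < +oo)%E.

(* normalized constant-speed parametrization of G (values outside [0,1]
   are irrelevant) *)
Definition normalized_cs_param (G : set V) (g : R -> V) : Prop :=
  [/\ {within `[0, 1]%classic, continuous g},
      {in `[0, 1]%classic &, injective g},
      g @` `[0, 1]%classic = G &
      forall t, 0 <= t <= 1 -> H1 (g @` `[0, t]%classic) = (t%:E * H1 G)%E].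

End Geometry.

Definition is_oracle {R : realType} (t : R) (O : nat -> rat) : Prop :=
  forall s : nat, `|ratr (O s) - t| <= (2%:R ^+ s)^-1.

Definition outputs_approx {R : realType} {n : nat} (M : code)
    (Os : seq (nat -> rat)) (r : nat) (x : 'rV[R]_n) : Prop :=
  exists k, eval (map (fun o => encq \o o) Os) M [:: r] k /\
            edist (map_mx ratr (@decpt n k)) x <= (2%:R ^+ r)^-1.

Definition computable_with {R : realType} {n : nat}
    (Oextra : seq (nat -> rat)) (f : R -> 'rV[R]_n) : Prop :=
  exists M : code, forall (t : R), 0 <= t <= 1 ->
    forall (Ot : nat -> rat), is_oracle t Ot ->
    forall r : nat, outputs_approx M (Ot :: Oextra) r (f t).

Definition computable {R : realType} {n : nat} (f : R -> 'rV[R]_n) : Prop :=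
  computable_with [::] f.

(* Main.v *)
(* A level-k candidate is a function from the grid points i/2^k, 0 <= i <= 2^k, to
   a grid of mesh 2^-k that is Lipschitz with constant l, comes near the first
   few samples gstar(q) at dyadic q, and starts at the right end of the curve,
   all up to O(2^-k).  Approximations of l from its oracle make this decidable,
   and there are finitely many candidates.  The rounding of gamma is always one.
   Conversely any limit f of candidates is l-Lipschitz and covers Gamma; as Gamma
   has length l and H^1 of an l-Lipschitz image of [s,t] is at most l(t-s), the
   function f must be gamma or its reversal, and the direction test excludes the
   latter.  So by compactness all candidates of some level agree up to 2^-r near
   the queried point; the machine searches for such a level and outputs the value
   of any candidate.  No modulus of convergence is computed, and uniqueness
   replaces an analysis of how gstar retraces the curve. *)
Require Import Defs.
From mathcomp Require Import all_boot all_order all_algebra.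
From mathcomp Require Import all_classical all_reals.
From mathcomp Require Import all_analysis.
From mathcomp Require Import zify ring lra.
Import Order.TTheory GRing.Theory Num.Theory.
Import numFieldNormedType.Exports.
(* [all_analysis] redefines [code] and [edist]. *)
Import Defs.
Set Implicit Arguments. Unset Strict Implicit. Unset Printing Implicit Defensive.

(** * Evaluation of codes *)

Local Open Scope nat_scope.

(** Not everything the machine uses has to be computed. The bound [A], the tolerance [E], a
    coordinate [c0] that tells the end points apart, the sign [beta] of their difference and the
    number [D] of spare digits are fixed by the curve alone and built into the code; only [t], the
    precision and the oracle for [l] vary. The point [t] enters through the single rational coded by
    [w], so agreement of the candidates is a decidable question about [w], whereas any test at [t]
    itself would compare reals. Samples of the curve raise another difficulty: the machine for
    [gstar] expects an oracle for its argument, but the oracles at hand belong to [t] and [l]. A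
    dyadic rational is its own constant oracle, and a constant oracle can be compiled into an
    ordinary argument. Since only dyadic points are sampled, their values must be dense in the
    curve; this rests on the continuity of [gstar], which comes from the finite use of oracles. *)

Section EvalInduction.
Variable os : seq (nat -> nat).
Variables (P : code -> seq nat -> nat -> Prop)
          (Q : seq code -> seq nat -> seq nat -> Prop).
Hypothesis P_zero : forall xs, P CZero xs 0.
Hypothesis P_succ : forall xs, P CSucc xs (nth 0 xs 0).+1.
Hypothesis P_proj : forall i xs, P (CProj i) xs (nth 0 xs i).
Hypothesis P_orc :
  forall j xs, P (COrc j) xs (nth (fun _ => 0) os j (nth 0 xs 0)).
Hypothesis P_comp : forall f gs xs ys y,
  evals os gs xs ys -> Q gs xs ys -> eval os f ys y -> P f ys y ->
  P (CComp f gs) xs y.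
Hypothesis P_prec0 : forall f g xs y,
  head 0 xs = 0 -> eval os f (behead xs) y -> P f (behead xs) y ->
  P (CPrec f g) xs y.
Hypothesis P_precS : forall f g k rest z y,
  eval os (CPrec f g) (k :: rest) z -> P (CPrec f g) (k :: rest) z ->
  eval os g (k :: z :: rest) y -> P g (k :: z :: rest) y ->
  P (CPrec f g) (k.+1 :: rest) y.
Hypothesis P_mu : forall f xs y,
  eval os f (y :: xs) 0 -> P f (y :: xs) 0 ->
  (forall k, k < y ->
     exists v, [/\ v <> 0, eval os f (k :: xs) v & P f (k :: xs) v]) ->
  P (CMu f) xs y.
Hypothesis Q_nil : forall xs, Q [::] xs [::].
Hypothesis Q_cons : forall g gs xs y ys,
  eval os g xs y -> P g xs y -> evals os gs xs ys -> Q gs xs ys ->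
  Q (g :: gs) xs (y :: ys).

(* The automatically generated scheme has no induction hypothesis for the
   evaluations nested in the premise of [ev_mu]. *)
Fixpoint eval_nested_ind c xs y (h : eval os c xs y) {struct h} : P c xs y :=
  match h in eval _ c xs y return P c xs y with
  | ev_zero xs => P_zero xs
  | ev_succ xs => P_succ xs
  | ev_proj i xs => P_proj i xs
  | ev_orc j xs => P_orc j xs
  | ev_comp f gs xs ys y hs hf =>
      P_comp hs (evals_nested_ind hs) hf (eval_nested_ind hf)
  | ev_prec0 f g xs y h0 hf => @P_prec0 f g xs y h0 hf (eval_nested_ind hf)
  | ev_precS f g k rest z y hr hg =>
      P_precS hr (eval_nested_ind hr) hg (eval_nested_ind hg)
  | ev_mu f xs y h0 hlt =>
      P_mu h0 (eval_nested_ind h0) (fun k lt_ky =>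
        match hlt k lt_ky with
        | ex_intro2 v v0 hv =>
            ex_intro _ v (And3 v0 hv (eval_nested_ind hv))
        end)
  end
with evals_nested_ind gs xs ys (h : evals os gs xs ys) {struct h} : Q gs xs ys :=
  match h in evals _ gs xs ys return Q gs xs ys with
  | evs_nil xs => Q_nil xs
  | evs_cons g gs xs y ys hg hs =>
      Q_cons hg (eval_nested_ind hg) hs (evals_nested_ind hs)
  end.

End EvalInduction.

Lemma eval_functional os c xs y y' :
  eval os c xs y -> eval os c xs y' -> y = y'.
Proof.
move=> h; move: y'.
pose P c xs y := forall y', eval os c xs y' -> y = y'.
pose Q gs xs ys := forall ys', evals os gs xs ys' -> ys = ys'.
move: c xs y h; apply: (@eval_nested_ind os P Q); rewrite ?/P ?/Q /=.
- by move=> xs y' h; inversion h.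
- by move=> xs y' h; inversion h.
- by move=> i xs y' h; inversion h.
- by move=> j xs y' h; inversion h.
- move=> f gs xs ys y _ IHs _ IHf y' h; inversion h as [| | | |? ? ? ? ? hs hf| | |]; subst.
  by apply: IHf; rewrite (IHs _ hs).
- move=> f g xs y h0 _ IH y' h; inversion h as [| | | | |? ? ? ? ? hf|? ? ? ? ? ? hr hg|]; subst; last by [].
  exact: IH.
- move=> f g k rest z y _ IHr _ IHg y' h; inversion h as [| | | | |? ? ? ? ? hf|? ? ? ? ? ? hr hg|]; subst; first by [].
  by apply: IHg; rewrite (IHr _ hr).
- move=> f xs y _ IH0 IHlt y' h; inversion h as [| | | | | | |? ? ? h0 hlt]; subst.
  case: (ltngtP y y') => // [lt1|lt2].
  + by case: (hlt _ lt1) => v v0 /IH0 e; case: v0; rewrite -e.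
  + by case: (IHlt _ lt2) => v [v0 _ /(_ _ h0) e]; case: v0.
- by move=> xs ys' h; inversion h.
- move=> g gs xs y ys _ IHg _ IHs ys' h; inversion h as [|? ? ? ? ? hg hs]; subst.
  by rewrite (IHg _ hg) (IHs _ hs).
Qed.

Definition agree_below N (os os' : seq (nat -> nat)) :=
  forall j i, i < N -> nth (fun _ => 0) os' j i = nth (fun _ => 0) os j i.

Lemma agree_belowW N N' os os' :
  N' <= N -> agree_below N os os' -> agree_below N' os os'.
Proof. by move=> le a j i lti; apply: a; apply: leq_trans le. Qed.

(** A derivation is a finite tree, so it meets only finitely many oracle positions. The continuity
    of computable functions rests on this. *)
Lemma eval_finite_use os c xs y : eval os c xs y ->
  exists N, forall os', agree_below N os os' -> eval os' c xs y.
Proof.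
pose P c xs y := exists N, forall os', agree_below N os os' -> eval os' c xs y.
pose Q gs xs ys := exists N, forall os', agree_below N os os' -> evals os' gs xs ys.
move: c xs y; apply: (@eval_nested_ind os P Q); rewrite ?/P ?/Q /=.
- by move=> xs; exists 0 => os' _; constructor.
- by move=> xs; exists 0 => os' _; constructor.
- by move=> i xs; exists 0 => os' _; constructor.
- move=> j xs; exists (nth 0 xs 0).+1 => os' a.
  by rewrite -(a j (nth 0 xs 0)) //; apply: ev_orc.
- move=> f gs xs ys y _ [N1 h1] _ [N2 h2]; exists (maxn N1 N2) => os' a.
  apply: ev_comp (h1 _ _) (h2 _ _); apply: agree_belowW a; lia.
- move=> f g xs y h0 _ [N h]; exists N => os' a.
  exact: (ev_prec0 _ h0 (h _ a)).
- move=> f g k rest z y _ [N1 h1] _ [N2 h2]; exists (maxn N1 N2) => os' a.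
  apply: ev_precS (h1 _ _) (h2 _ _); apply: agree_belowW a; lia.
- move=> f xs y _ [N1 h1] hlt.
  (* Each [k < y] comes with its own bound; an inner induction on [y] takes their maximum. *)
  have [N2 h2] : exists N, forall os', agree_below N os os' ->
      forall k, k < y -> exists2 v, v <> 0 & eval os' f (k :: xs) v.
    elim: y hlt {h1} => [|y IH] hlt; first by exists 0.
    have [k lk|N hN] := IH; first by apply: hlt; lia.
    have [v [v0 _ [N' hN']]] := hlt y (ltnSn y).
    exists (maxn N N') => os' a k; rewrite ltnS leq_eqVlt => /orP [/eqP->|lk].
      exists v => //; apply: hN'; apply: agree_belowW a; lia.
    apply: hN => //; apply: agree_belowW a; lia.
  exists (maxn N1 N2) => os' a; apply: ev_mu.
    apply: h1; apply: agree_belowW a; lia.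
  apply: h2; apply: agree_belowW a; lia.
- by move=> xs; exists 0 => os' _; constructor.
- move=> g gs xs y ys _ [N1 h1] _ [N2 h2]; exists (maxn N1 N2) => os' a.
  constructor; [apply: h1|apply: h2]; apply: agree_belowW a; lia.
Qed.

(* Codes accept argument lists of any length, so forwarding the arguments past
   an additional parameter needs a bound on the number of those inspected. *)
Fixpoint arity (c : code) : nat :=
  match c with
  | CZero => 0
  | CSucc => 1
  | CProj i => i.+1
  | COrc _ => 1
  | CComp _ gs => foldr maxn 0 (map arity gs)
  | CPrec f g => maxn (arity f).+1 (arity g)
  | CMu f => arity f
  end.

Definition projs (j m : nat) : seq code := [seq CProj (j + i) | i <- iota 0 m].

(* [param_orc c] runs [c] with the oracle that is constantly equal to the
   additional first argument. *)
Fixpoint param_orc (c : code) : code :=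
  match c with
  | CZero => CZero
  | CSucc => CComp CSucc [:: CProj 1]
  | CProj i => CProj i.+1
  | COrc 0 => CProj 0
  | COrc _.+1 => CZero
  | CComp f gs => CComp (param_orc f) (CProj 0 :: map param_orc gs)
  | CPrec f g =>
      let m := maxn (arity f).+1 (arity g) in
      CComp (CPrec (param_orc f)
                   (CComp (param_orc g)
                          [:: CProj 2, CProj 0, CProj 1 & projs 3 m]))
            [:: CProj 1, CProj 0 & projs 2 m]
  | CMu f =>
      CMu (CComp (param_orc f) [:: CProj 1, CProj 0 & projs 2 (arity f)])
  end.

Definition window (j m : nat) (xs : seq nat) : seq nat :=
  [seq nth 0 xs (j + i) | i <- iota 0 m].

Lemma evals_projs os j m xs : evals os (projs j m) xs (window j m xs).
Proof.
rewrite /projs /window; elim: (iota 0 m) => [|i s IH] /=; constructor => //.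
exact: ev_proj.
Qed.

Lemma nth_window j m xs i : i < m -> nth 0 (window j m xs) i = nth 0 xs (j + i).
Proof. by move=> lt; rewrite (nth_map 0) ?size_iota // nth_iota. Qed.

(** [CPrec] recurses on its first argument, so the oracle value [w] has to move behind the counter
    during the recursion. This is the code that runs on the permuted arguments. *)
Definition prec_inner f g :=
  CPrec (param_orc f)
    (CComp (param_orc g) [:: CProj 2, CProj 0, CProj 1
                           & projs 3 (maxn (arity f).+1 (arity g))]).

(** Arguments may differ beyond [arity c] because forwarding cuts them off there. For [CPrec] the
    induction hypothesis on the smaller counter is needed for the inner recursion, before the
    arguments are permuted back; hence the second half of [P]. *)
Lemma param_orcP w c xs y : eval [:: fun _ => w] c xs y ->
  forall os ys, (forall i, i < arity c -> nth 0 ys i = nth 0 xs i) ->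
  eval os (param_orc c) (w :: ys) y.
Proof.
move=> h.
pose eqon m (ys xs : seq nat) := forall i, i < m -> nth 0 ys i = nth 0 xs i.
pose P c xs y := forall os ys, eqon (arity c) ys xs ->
  eval os (param_orc c) (w :: ys) y /\
  forall f g, c = CPrec f g ->
    eval os (prec_inner f g)
      [:: nth 0 ys 0, w & window 1 (maxn (arity f).+1 (arity g)) ys] y.
pose Q gs xs zs := forall os ys, eqon (foldr maxn 0 (map arity gs)) ys xs ->
  evals os (map param_orc gs) (w :: ys) zs.
suff : P c xs y by move=> H os ys a; case: (H os ys a).
have prec_outer f g os ys y' :
    eval os (prec_inner f g)
      [:: nth 0 ys 0, w & window 1 (maxn (arity f).+1 (arity g)) ys] y' ->
    eval os (param_orc (CPrec f g)) (w :: ys) y'.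
  move=> hi; apply: ev_comp hi.
  constructor; first exact: (ev_proj _ 1 (w :: ys)).
  constructor; first exact: (ev_proj _ 0 (w :: ys)).
  exact: (evals_projs _ 2 _ (w :: ys)).
move: c xs y h; apply: (@eval_nested_ind [:: fun _ => w] P Q); rewrite ?/P ?/Q /=.
- by move=> xs os ys _; split => //; constructor.
- move=> xs os ys /(_ 0 isT) <-; split => //.
  apply: (@ev_comp _ _ _ _ [:: nth 0 ys 0]); last exact: ev_succ.
  by constructor; [exact: (ev_proj _ 1 (w :: ys))|constructor].
- move=> i xs os ys /(_ i (ltnSn _)) <-; split => //.
  exact: (ev_proj _ i.+1 (w :: ys)).
- move=> [|j] xs os ys _; split => //=; first exact: (ev_proj _ 0 (w :: ys)).
  by rewrite nth_nil; constructor.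
- move=> f gs xs zs y _ IHs _ IHf os ys a; split => //.
  apply: (@ev_comp _ _ _ _ (w :: zs)).
    by constructor; [exact: (ev_proj _ 0 (w :: ys))|exact: IHs].
  by case: (IHf os zs).
- move=> f g xs y h0 _ IH os ys a.
  have hi : eval os (prec_inner f g)
      [:: nth 0 ys 0, w & window 1 (maxn (arity f).+1 (arity g)) ys] y.
    rewrite (a 0) ?nth0; last by rewrite /=; lia.
    rewrite h0; apply: ev_prec0 => //.
    case: (IH os (window 1 (maxn (arity f).+1 (arity g)) ys)) => // i lti.
    rewrite nth_window ?nth_behead ?add1n ?a //=; lia.
  by split => [|? ? [<- <-] //]; exact: prec_outer.
- move=> f g k rest z y _ IHr _ IHg os ys a.
  have a0 : nth 0 ys 0 = k.+1 by rewrite (a 0) //=; lia.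
  set m := maxn (arity f).+1 (arity g).
  have hi : eval os (prec_inner f g) [:: nth 0 ys 0, w & window 1 m ys] y.
    rewrite a0; apply: (@ev_precS _ _ _ _ _ z).
      have [|_ /(_ f g erefl)] := IHr os (k :: behead ys).
        by case=> [|i] //= lti; rewrite nth_behead (a i.+1).
      rewrite /= -/m; set u := window 1 m _; suff -> : u = window 1 m ys by [].
      by apply: eq_map => i; rewrite /= !add1n /= nth_behead.
    apply: (@ev_comp _ _ _ _ [:: w, k, z & window 3 m [:: k, z, w & window 1 m ys]]).
      constructor; first exact: (ev_proj _ 2).
      constructor; first exact: (ev_proj _ 0).
      constructor; first exact: (ev_proj _ 1).
      exact: evals_projs.
    case: (IHg os [:: k, z & window 3 m [:: k, z, w & window 1 m ys]]) => //.
    case=> [|[|i]] //= lti.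
    rewrite nth_window /= ?nth_window ?add1n; try by rewrite /m; lia.
    by rewrite (a i.+1) //=; lia.
  by split => [|? ? [<- <-] //]; exact: prec_outer.
- move=> f xs y _ IH0 IHlt os ys a; split => //.
  have step k v : P f (k :: xs) v ->
      eval os (CComp (param_orc f) [:: CProj 1, CProj 0 & projs 2 (arity f)])
           [:: k, w & ys] v.
    move=> IH.
    apply: (@ev_comp _ _ _ _ [:: w, k & window 2 (arity f) [:: k, w & ys]]).
      constructor; first exact: (ev_proj _ 1).
      constructor; first exact: (ev_proj _ 0).
      exact: evals_projs.
    case: (IH os (k :: window 2 (arity f) [:: k, w & ys])) => //.
    case=> [|i] //= lti; rewrite nth_window /= ?a //; lia.
  apply: ev_mu; first exact: step.
  move=> k /IHlt [v [v0 _ IH]]; exists v => //; exact: step.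
- by move=> xs os ys _; constructor.
- move=> g gs xs y zs _ IHg _ IHs os ys a; constructor.
    by case: (IHg os ys) => // i lti; apply: a; lia.
  by apply: IHs => i lti; apply: a; lia.
Qed.

(** * Total functions computable with one fixed oracle *)

Section Recursive.
Variable ol : nat -> nat.

(* The code is uniform in the first oracle, the one for the argument [t]. *)
Definition recf (m : nat) (F : seq nat -> nat) : Prop :=
  exists c, forall ot xs, size xs = m -> eval [:: ot; ol] c xs (F xs).

Definition recb (m : nat) (p : seq nat -> bool) : Prop :=
  recf m (fun xs => nat_of_bool (p xs)).

(** Stated as closure under composition, so that a computability proof follows the syntax of the
    function. *)
Definition rec1 (f : nat -> nat) := forall m A, recf m A ->
  recf m (fun xs => f (A xs)).
Definition rec2 (f : nat -> nat -> nat) := forall m A B, recf m A -> recf m B ->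
  recf m (fun xs => f (A xs) (B xs)).
Definition rec3 (f : nat -> nat -> nat -> nat) := forall m A B D,
  recf m A -> recf m B -> recf m D -> recf m (fun xs => f (A xs) (B xs) (D xs)).

Lemma recf_ext m F G : (forall xs, size xs = m -> F xs = G xs) ->
  recf m F -> recf m G.
Proof. by move=> e [c h]; exists c => ot xs sx; rewrite -e //; apply: h. Qed.

(** [b] counts the binders crossed: every bounded quantifier or sum puts its variable in front, so
    outer arguments appear under [behead]. *)
Lemma recf_var b j m : recf m (fun xs => nth 0 (iter b behead xs) j).
Proof.
exists (CProj (b + j)) => ot xs _.
have -> : nth 0 (iter b behead xs) j = nth 0 xs (b + j).
  by elim: b j => [|b IH] j //=; rewrite nth_behead IH addnS.
exact: ev_proj.
Qed.

Lemma recf_comp m (Fs : seq (seq nat -> nat)) G :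
  (forall F, List.In F Fs -> recf m F) -> recf (size Fs) G ->
  recf m (fun xs => G [seq F xs | F <- Fs]).
Proof.
move=> hF [c hc].
have [cs hcs] : exists cs, forall ot xs, size xs = m ->
    evals [:: ot; ol] cs xs [seq F xs | F <- Fs].
  elim: Fs hF {hc} => [|F Fs IH] hF; first by exists [::] => *; constructor.
  have [c1 h1] : recf m F by apply: hF; left.
  have [F' inF'|cs h2] := IH; first by apply: hF; right.
  by exists (c1 :: cs) => ot xs sx; constructor; [apply: h1|apply: h2].
exists (CComp c cs) => ot xs sx; apply: ev_comp (hcs _ _ sx) (hc _ _ _).
by rewrite size_map.
Qed.

Lemma rec1I f : recf 1 (fun xs => f (nth 0 xs 0)) -> rec1 f.
Proof.
move=> h m A hA; apply: (@recf_comp m [:: A]) h => F /=.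
by case=> [<-|].
Qed.

Lemma rec2I f : recf 2 (fun xs => f (nth 0 xs 0) (nth 0 xs 1)) -> rec2 f.
Proof.
move=> h m A B hA hB; apply: (@recf_comp m [:: A; B]) h => F /=.
by case=> [<-|[<-|]].
Qed.

Lemma rec3I f :
  recf 3 (fun xs => f (nth 0 xs 0) (nth 0 xs 1) (nth 0 xs 2)) -> rec3 f.
Proof.
move=> h m A B D hA hB hD; apply: (@recf_comp m [:: A; B; D]) h => F /=.
by case=> [<-|[<-|[<-|]]].
Qed.

Lemma rec1_succ : rec1 succn.
Proof. by apply: rec1I; exists CSucc => ot xs _; apply: ev_succ. Qed.

Lemma recf_const k m : recf m (fun _ => k).
Proof.
elim: k => [|k IH]; last exact: rec1_succ.
by exists CZero => ot xs _; apply: ev_zero.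
Qed.

Lemma rec1_oracle : rec1 ol.
Proof. by apply: rec1I; exists (COrc 1) => ot xs _; apply: (ev_orc _ 1). Qed.

Lemma recf_vars m H s :
  List.In H [seq (fun xs => nth 0 xs i) | i <- s] -> recf m H.
Proof.
by elim: s => [|i s IH] //= [<-|/IH //]; exact: (@recf_var 0).
Qed.

Lemma recf_prec m (F : seq nat -> nat) (G : nat -> nat -> seq nat -> nat)
    (N : seq nat -> nat) :
  recf m F ->
  recf m.+2 (fun ys => G (nth 0 ys 0) (nth 0 ys 1) (behead (behead ys))) ->
  recf m N ->
  recf m (fun xs => nat_rect (fun _ => nat) (F xs) (fun i z => G i z xs) (N xs)).
Proof.
move=> [cF hF] [cG hG] hN.
have hP : recf m.+1 (fun ys => nat_rect (fun _ => nat) (F (behead ys))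
    (fun i z => G i z (behead ys)) (nth 0 ys 0)).
  exists (CPrec cF cG) => ot [|k xs] //= [sx].
  elim: k => [|k IH] /=; first by apply: ev_prec0 => //=; apply: hF.
  by apply: ev_precS IH _; apply: hG; rewrite /= sx.
pose vars := [seq (fun xs => nth 0 xs i) | i <- iota 0 m].
have := @recf_comp m (N :: vars).
rewrite /= size_map size_iota => /(_ _ _ hP) h.
apply: recf_ext (h _) => [xs sx /=|H [<-//|/recf_vars//]].
suff -> : [seq H xs | H <- vars] = xs by [].
by rewrite -map_comp -[RHS](mkseq_nth 0) sx.
Qed.

Lemma rec2_add : rec2 addn.
Proof.
apply: rec2I; apply: recf_ext (@recf_prec 2 _ (fun _ z _ => z.+1) _
  (@recf_var 0 1 2) _ (@recf_var 0 0 2)) => [xs _|].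
  by move: (nth 0 xs 0) => a /=; elim: a => //= a ->.
exact: rec1_succ (@recf_var 0 1 _).
Qed.

Lemma rec1_pred : rec1 predn.
Proof.
apply: rec1I; apply: recf_ext (@recf_prec 1 _ (fun i _ _ => i) _
  (@recf_const 0 1) _ (@recf_var 0 0 1)) => [xs _|].
  by case: (nth 0 xs 0).
exact: (@recf_var 0 0 _).
Qed.

Lemma rec2_sub : rec2 subn.
Proof.
apply: rec2I; apply: recf_ext (@recf_prec 2 _ (fun _ z _ => z.-1) _
  (@recf_var 0 0 2) _ (@recf_var 0 1 2)) => [xs _|].
  by elim: (nth 0 xs 1) => [|b /= ->]; rewrite ?subn0 ?subnS.
exact: rec1_pred (@recf_var 0 1 _).
Qed.

Lemma rec2_mul : rec2 muln.
Proof.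
apply: rec2I; apply: recf_ext (@recf_prec 2 _ (fun _ z xs => nth 0 xs 1 + z) _
  (@recf_const 0 2) _ (@recf_var 0 0 2)) => [xs _|].
  by elim: (nth 0 xs 0) => [|a /= ->] //; rewrite mulSn.
exact: rec2_add (@recf_var 2 1 _) (@recf_var 0 1 _).
Qed.

Lemma rec2_exp : rec2 expn.
Proof.
apply: rec2I; apply: recf_ext (@recf_prec 2 _ (fun _ z xs => nth 0 xs 0 * z) _
  (@recf_const 1 2) _ (@recf_var 0 1 2)) => [xs _|].
  by elim: (nth 0 xs 1) => [|a /= ->] //; rewrite expnS.
exact: rec2_mul (@recf_var 2 0 _) (@recf_var 0 1 _).
Qed.

(* The bound variable of the sum is the first argument of the summand. *)
Lemma recf_sum m (N : seq nat -> nat) (G : nat -> seq nat -> nat) :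
  recf m N -> recf m.+1 (fun ys => G (nth 0 ys 0) (behead ys)) ->
  recf m (fun xs => \sum_(i < N xs) G i xs).
Proof.
move=> hN hG; apply: recf_ext (@recf_prec m _ (fun i z xs => z + G i xs) _
  (@recf_const 0 m) _ hN) => [xs _|].
  by elim: (N xs) => [|k /= ->]; rewrite ?big_ord0 // big_ord_recr.
apply: rec2_add; first exact: (@recf_var 0 1 _).
pose vars := (fun xs => nth 0 xs 0) :: [seq (fun xs => nth 0 xs i) | i <- iota 2 m].
have := @recf_comp m.+2 vars; rewrite /= size_map size_iota => /(_ _ _ hG) h.
apply: recf_ext (h _) => [[|a [|b xs]] //= [sx]|H [<-|/recf_vars//]].
- congr (G a _); rewrite -map_comp -[RHS](mkseq_nth 0) sx /mkseq.
  by rewrite (iotaDl 2 0) -map_comp.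
- exact: (@recf_var 0).
Qed.

Lemma recf_bigsum n m (G : 'I_n -> seq nat -> nat) :
  (forall i, recf m (G i)) -> recf m (fun xs => \sum_(i < n) G i xs).
Proof.
elim: n G => [|n IH] G h.
  by apply: recf_ext (@recf_const 0 m) => xs _; rewrite big_ord0.
apply: recf_ext (rec2_add (IH _ (fun i => h (widen_ord (leqnSn n) i)))
  (h ord_max)) => xs _.
by rewrite big_ord_recr.
Qed.

Lemma recb_not m p : recb m p -> recb m (fun xs => ~~ p xs).
Proof.
move=> h; apply: recf_ext (rec2_sub (recf_const 1 m) h) => xs _.
by case: (p xs).
Qed.

Lemma recb_and m p q : recb m p -> recb m q -> recb m (fun xs => p xs && q xs).
Proof. by move=> h1 h2; apply: recf_ext (rec2_mul h1 h2) => xs _; rewrite mulnb. Qed.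

Lemma recb_imp m p q : recb m p -> recb m q -> recb m (fun xs => p xs ==> q xs).
Proof.
move=> h1 h2; apply: recf_ext (recb_not (recb_and h1 (recb_not h2))) => xs _.
by case: (p xs); case: (q xs).
Qed.

Lemma recb_leq m A B : recf m A -> recf m B -> recb m (fun xs => A xs <= B xs).
Proof.
move=> h1 h2; apply: recf_ext (rec2_sub (recf_const 1 m) (rec2_sub h1 h2)) => xs _.
by rewrite /leq; case: (_ - B xs).
Qed.

Lemma recb_eq m A B : recf m A -> recf m B -> recb m (fun xs => A xs == B xs).
Proof.
move=> h1 h2; apply: recf_ext (recb_and (recb_leq h1 h2) (recb_leq h2 h1)) => xs _.
by rewrite -eqn_leq.
Qed.

(** The failures are counted by a sum, which is then compared with 0. *)
Lemma recb_forall m N (p : nat -> seq nat -> bool) :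
  recf m N -> recb m.+1 (fun ys => p (nth 0 ys 0) (behead ys)) ->
  recb m (fun xs => [forall i : 'I_(N xs), p i xs]).
Proof.
move=> hN hp.
have h := @recf_sum m N (fun i xs => nat_of_bool (~~ p i xs)) hN (recb_not hp).
apply: recf_ext (recb_eq h (recf_const 0 m)) => xs _; congr nat_of_bool.
rewrite sum_nat_eq0; apply/forallP/forallP => h' i; have := h' i; by case: (p i xs).
Qed.

Lemma recb_exists m N (p : nat -> seq nat -> bool) :
  recf m N -> recb m.+1 (fun ys => p (nth 0 ys 0) (behead ys)) ->
  recb m (fun xs => [exists i : 'I_(N xs), p i xs]).
Proof.
move=> hN hp.
have h := @recb_forall m N (fun i xs => ~~ p i xs) hN (recb_not hp).
by apply: recf_ext (recb_not h) => xs _; rewrite negb_forall; congr nat_of_bool;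
  apply/existsP/existsP => -[i pi]; exists i; move: pi; rewrite negbK.
Qed.

Lemma recf_if m p A B : recb m p -> recf m A -> recf m B ->
  recf m (fun xs => if p xs then A xs else B xs).
Proof.
move=> hp hA hB; apply: recf_ext
  (rec2_add (rec2_mul hp hA) (rec2_mul (recb_not hp) hB)) => xs _.
by case: (p xs) => /=; rewrite mul1n mul0n ?addn0.
Qed.

Lemma sum_ltn_ord a q : \sum_(i < a) (i < q) = minn a q.
Proof.
elim: a => [|a IH]; first by rewrite big_ord0 min0n.
by rewrite big_ord_recr /= IH; case: ltnP; lia.
Qed.

(** The quotient is the number of positive multiples of the divisor up to the dividend. The guard
    yields 0 for divisor 0, as [divn] does. *)
Lemma rec2_div : rec2 divn.
Proof.
apply: rec2I.
have h : recf 2 (fun xs => \sum_(i < nth 0 xs 0)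
    ((0 < nth 0 xs 1) && (i.+1 * nth 0 xs 1 <= nth 0 xs 0))).
  apply: (@recf_sum 2 _ (fun i xs => nat_of_bool
    ((0 < nth 0 xs 1) && (i.+1 * nth 0 xs 1 <= nth 0 xs 0)))).
    exact: (@recf_var 0).
  apply: recb_and; apply: recb_leq.
  - exact: recf_const.
  - exact: (@recf_var 1).
  - by apply: rec2_mul; [apply: rec1_succ; exact: (@recf_var 0)|exact: (@recf_var 1)].
  - exact: (@recf_var 1).
apply: recf_ext h => xs _; move: (nth 0 xs 0) (nth 0 xs 1) => a [|b].
  by rewrite divn0 big1.
under eq_bigr => i _ do rewrite /= -leq_divRL //.
by rewrite sum_ltn_ord; apply/minn_idPr; apply: leq_div.
Qed.

Lemma rec2_mod : rec2 modn.
Proof.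
move=> m A B hA hB.
apply: recf_ext (rec2_sub hA (rec2_mul (rec2_div hA hB) hB)) => xs _.
by rewrite {1}(divn_eq (A xs) (B xs)) addKn.
Qed.

Lemma recb_odd m A : recf m A -> recb m (fun xs => odd (A xs)).
Proof.
by move=> h; apply: recf_ext (rec2_mod h (recf_const 2 m)) => xs _; rewrite modn2.
Qed.

Lemma rec1_half : rec1 half.
Proof.
by move=> m A h; apply: recf_ext (rec2_div h (recf_const 2 m)) => xs _;
  rewrite divn2.
Qed.

Lemma rec1_double : rec1 double.
Proof.
by move=> m A h; apply: recf_ext (rec2_mul h (recf_const 2 m)) => xs _;
  rewrite muln2.
Qed.

Lemma rec2_min : rec2 minn.
Proof. by move=> m A B hA hB; apply: recf_if => //; apply: recb_leq => //; apply: rec1_succ. Qed.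

Lemma rec1_logn2 : rec1 (fun k => logn 2 k.+1).
Proof.
apply: rec1I.
have h : recf 1 (fun xs => \sum_(i < nth 0 xs 0)
    ((nth 0 xs 0).+1 %% 2 ^ i.+1 == 0)).
  apply: (@recf_sum 1 _ (fun i xs => nat_of_bool ((nth 0 xs 0).+1 %% 2 ^ i.+1 == 0))).
    exact: (@recf_var 0).
  apply: recb_eq; last exact: recf_const.
  apply: rec2_mod; first by apply: rec1_succ; exact: (@recf_var 1).
  apply: rec2_exp; first exact: recf_const.
  by apply: rec1_succ; exact: (@recf_var 0).
apply: recf_ext h => xs _; move: (nth 0 xs 0) => k.
by rewrite logn_count_dvd // big_add1 big_mkord.
Qed.

Lemma rec1_nunpair1 : rec1 (fun k => (nunpair k).1).
Proof. exact: rec1_logn2. Qed.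

Lemma rec1_nunpair2 : rec1 (fun k => (nunpair k).2).
Proof.
move=> m A hA; apply: rec1_half; apply: rec2_div; first exact: rec1_succ.
by apply: rec2_exp; [exact: recf_const|exact: rec1_logn2].
Qed.

Lemma rec2_npair : rec2 npair.
Proof.
move=> m A B hA hB; apply: rec1_pred; apply: rec2_mul.
  by apply: rec2_exp => //; exact: recf_const.
by apply: rec1_succ; apply: rec1_double.
Qed.

Lemma rec1_decseq n j : j < n -> rec1 (fun k => nth 0 (decseq n k) j).
Proof.
elim: n j => [//|n IH] [_|j /IH h] m A hA /=; first exact: rec1_nunpair1.
by apply: h; apply: rec1_nunpair2.
Qed.

End Recursive.

Lemma nunpairK a b : nunpair (npair a b) = (a, b).
Proof.
rewrite /nunpair /npair prednK ?muln_gt0 ?expn_gt0 //.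
have -> : logn 2 (2 ^ a * b.*2.+1) = a.
  rewrite lognM ?expn_gt0 // pfactorK // lognE /= dvdn2 /= odd_double /= addn0 //.
by rewrite mulKn ?expn_gt0 //= uphalf_double.
Qed.

Local Open Scope classical_set_scope.
Local Open Scope ring_scope.

(** * Euclidean distance *)

Section Edist.
Context {R : realType} {n : nat}.
Implicit Types x y z : 'rV[R]_n.

Lemma edist_ge0 x y : 0 <= edist x y.
Proof. exact: sqrtr_ge0. Qed.

Lemma edistC x y : edist x y = edist y x.
Proof. by congr Num.sqrt; apply: eq_bigr => i _; rewrite -sqrrN opprB. Qed.

Lemma edistxx x : edist x x = 0.
Proof. by rewrite /edist big1 ?sqrtr0 // => i _; rewrite subrr expr0n. Qed.

Lemma sum_sqr_ge0 (I : finType) (a : I -> R) : 0 <= \sum_i a i ^+ 2.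
Proof. by apply: sumr_ge0 => i _; exact: sqr_ge0. Qed.

Lemma sqr_edist x y : edist x y ^+ 2 = \sum_(i < n) (x ord0 i - y ord0 i) ^+ 2.
Proof. by rewrite sqr_sqrtr ?sum_sqr_ge0. Qed.

Lemma edist_le x y (e : R) : 0 <= e ->
  (edist x y <= e) = (\sum_(i < n) (x ord0 i - y ord0 i) ^+ 2 <= e ^+ 2).
Proof. by move=> e0; rewrite -sqr_edist ler_pXn2r ?nnegrE ?edist_ge0. Qed.

Lemma coord_le_edist x y i : `|x ord0 i - y ord0 i| <= edist x y.
Proof.
rewrite -sqrtr_sqr ler_sqrt ?sum_sqr_ge0 // (bigD1 i) //= lerDl.
by apply: sumr_ge0 => j _; exact: sqr_ge0.
Qed.

Lemma edist_eq0 x y : edist x y = 0 -> x = y.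
Proof.
move=> e; apply/rowP => i; apply/eqP; rewrite -subr_eq0 -normr_le0 -e.
exact: coord_le_edist.
Qed.

(** The crude factor [n], instead of its square root, keeps later error constants free of roots. *)
Lemma edist_le_coord x y (e : R) : 0 <= e ->
  (forall i, `|x ord0 i - y ord0 i| <= e) -> edist x y <= n%:R * e.
Proof.
move=> e0 h; rewrite edist_le ?mulr_ge0 // exprMn.
apply: (@le_trans _ _ (\sum_(i < n) e ^+ 2)).
  by apply: ler_sum => i _; rewrite -real_normK ?num_real // ler_pXn2r ?nnegrE.
rewrite sumr_const card_ord -[X in X <= _]mulr_natl.
apply: ler_wpM2r; first exact: sqr_ge0.
by rewrite -natrX ler_nat; case: n => // k; rewrite leq_pmulr.
Qed.

Lemma Cauchy_Schwarz_sum (a b : 'I_n -> R) :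
  (\sum_i a i * b i) ^+ 2 <= (\sum_i a i ^+ 2) * (\sum_i b i ^+ 2).
Proof.
set A := \sum_i a i ^+ 2; set B := \sum_i b i ^+ 2; set C := \sum_i _.
have A0 : 0 <= A by exact: sum_sqr_ge0.
have : 0 <= B by exact: sum_sqr_ge0.
rewrite le_eqVlt => /orP [/eqP B0|B0].
  suff -> : C = 0 by rewrite expr0n /= -B0 mulr0.
  apply: big1 => i _; suff -> : b i = 0 by rewrite mulr0.
  have := @psumr_eq0P _ _ predT (fun i => b i ^+ 2) (fun i _ => sqr_ge0 _) (esym B0) i isT.
  by move/eqP; rewrite sqrf_eq0 => /eqP.
have : 0 <= \sum_i (B * a i - C * b i) ^+ 2 by exact: sum_sqr_ge0.
have -> : \sum_i (B * a i - C * b i) ^+ 2 = B * (A * B - C ^+ 2).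
  under eq_bigr => i _ do
    have -> : (B * a i - C * b i) ^+ 2 =
      B ^+ 2 * a i ^+ 2 - 2 * B * C * (a i * b i) + C ^+ 2 * b i ^+ 2 by ring.
  rewrite big_split sumrB -!mulr_sumr -/A -/B -/C /=; ring.
by rewrite pmulr_rge0 // subr_ge0.
Qed.

Lemma edist_triangle y x z : edist x z <= edist x y + edist y z.
Proof.
rewrite edist_le ?addr_ge0 ?edist_ge0 // sqrrD !sqr_edist.
set a := fun i : 'I_n => x ord0 i - y ord0 i.
set b := fun i : 'I_n => y ord0 i - z ord0 i.
have h : \sum_i a i * b i <= edist x y * edist y z.
  apply: le_trans (ler_norm _) _; rewrite -sqrtr_sqr -sqrtrM ?sum_sqr_ge0 //.
  by rewrite ler_sqrt ?Cauchy_Schwarz_sum // mulr_ge0 ?sum_sqr_ge0.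
have -> : \sum_(i < n) (x ord0 i - z ord0 i) ^+ 2 =
    \sum_i a i ^+ 2 + (\sum_i a i * b i) *+ 2 + \sum_i b i ^+ 2.
  rewrite -sumrMnl -!big_split /=; apply: eq_bigr => i _.
  by rewrite /a /b -mulr_natl; ring.
by rewrite lerD2r lerD2l ler_pMn2r.
Qed.

Lemma edist_lip y x x' : `|edist y x - edist y x'| <= edist x x'.
Proof.
rewrite ler_norml; have := edist_triangle x y x'; have := edist_triangle x' y x.
by rewrite (edistC x' x); lra.
Qed.

(** Stated for any filter, since it serves both for continuity and for limits along an
    ultrafilter. *)
Lemma cvg_edist (T : Type) (F : set_system T) (f g : T -> 'rV[R]_n) x y :
  Filter F ->
  (forall i, f t ord0 i @[t --> F] --> x ord0 i) ->
  (forall i, g t ord0 i @[t --> F] --> y ord0 i) ->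
  edist (f t) (g t) @[t --> F] --> edist x y.
Proof.
move=> FF cf cg; apply: (@cvg_comp _ _ _ _ Num.sqrt); last exact: sqrt_continuous.
elim: (index_enum _) => [|i s IH].
  under eq_fun do rewrite big_nil; rewrite big_nil; exact: cvg_cst.
under eq_fun do rewrite big_cons; rewrite big_cons; apply: cvgD => //.
rewrite expr2; under eq_fun do rewrite expr2.
by apply: cvgM; apply: cvgB.
Qed.

Lemma continuous_edist (T : topologicalType) (f g : T -> 'rV[R]_n) :
  continuous f -> continuous g -> continuous (fun t => edist (f t) (g t)).
Proof.
move=> cf cg t; apply: cvg_edist => i.
- exact: (cvg_comp _ _ (cf t) (@coord_continuous _ _ _ ord0 i (f t))).
- exact: (cvg_comp _ _ (cg t) (@coord_continuous _ _ _ ord0 i (g t))).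
Qed.

End Edist.

(** * Hausdorff measure of arcs *)

Section HausdorffMeasure.
Context {R : realType} {n : nat}.
Local Notation V := 'rV[R]_n.
Implicit Types A B E : set V.

Lemma ediam_ge0 E : (0 <= ediam E)%E.
Proof. by apply: ereal_sup_ubound; right. Qed.

Lemma ediam_le E (e : R) : 0 <= e -> (forall x y, E x -> E y -> edist x y <= e) ->
  (ediam E <= e%:E)%E.
Proof.
move=> e0 h; apply: ge_ereal_sup => _ [[x [y [Ex [Ey ->]]]]|->]; last by rewrite lee_fin.
by rewrite lee_fin; apply: h.
Qed.

Lemma edist_le_ediam E x y : E x -> E y -> ((edist x y)%:E <= ediam E)%E.
Proof. by move=> Ex Ey; apply: ereal_sup_ubound; left; exists x, y. Qed.

Lemma le_ediam A B : A `<=` B -> (ediam A <= ediam B)%E.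
Proof.
move=> AB; apply: ge_ereal_sup => _ [[x [y [Ax [Ay ->]]]]|->]; last exact: ediam_ge0.
by apply: edist_le_ediam; apply: AB.
Qed.

Lemma ediam_set0 : ediam (@set0 V) = 0%E.
Proof.
apply/eqP; rewrite eq_le ediam_ge0 andbT; apply: ge_ereal_sup.
by move=> _ [[x [y [] //]]|->].
Qed.

Lemma H1delta_le_cover (d : R) A (E : nat -> set V) :
  A `<=` \bigcup_i E i -> (forall i, (ediam (E i) <= d%:E)%E) ->
  (H1delta d A <= \sum_(i <oo) ediam (E i))%E.
Proof. by move=> h1 h2; apply: ereal_inf_lbound; exists E. Qed.

Lemma H1delta_le_H1 (d : R) A : 0 < d -> (H1delta d A <= H1 A)%E.
Proof. by move=> d0; apply: ereal_sup_ubound; exists d. Qed.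

Lemma H1_le A (x : \bar R) : (forall d : R, 0 < d -> (H1delta d A <= x)%E) ->
  (H1 A <= x)%E.
Proof. by move=> h; apply: ge_ereal_sup => _ [d d0 ->]; apply: h. Qed.

Lemma H1delta_ge0 (d : R) A : (0 <= H1delta d A)%E.
Proof.
apply: le_ereal_inf_tmp => _ [E [_ _ ->]]; apply: nneseries_ge0 => i _ _.
exact: ediam_ge0.
Qed.

Lemma H1_ge0 A : (0 <= H1 A)%E.
Proof. by apply: le_trans (H1delta_ge0 1 A) _; apply: H1delta_le_H1. Qed.

Lemma le_H1delta_mesh (d d' : R) A : d <= d' -> (H1delta d' A <= H1delta d A)%E.
Proof.
move=> le; apply: le_ereal_inf_tmp => _ [E [h1 h2 ->]].
by apply: H1delta_le_cover => // i; apply: le_trans (h2 i) _; rewrite lee_fin.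
Qed.

Lemma le_H1 A B : A `<=` B -> (H1 A <= H1 B)%E.
Proof.
move=> AB; apply: H1_le => d d0; apply: le_trans (H1delta_le_H1 B d0).
apply: le_ereal_inf_tmp => _ [E [h1 h2 ->]].
by apply: H1delta_le_cover => // x /AB /h1.
Qed.

(* Below the mesh [m] no set of a cover meets both [A] and [B]. *)
Lemma H1_separated A B (m : R) : 0 < m ->
  (forall x y, A x -> B y -> m <= edist x y) ->
  (H1 A + H1 B <= H1 (A `|` B))%E.
Proof.
move=> m0 sep.
have key d : 0 < d -> d < m ->
    (H1delta d A + H1delta d B <= H1 (A `|` B))%E.
  move=> d0 dm; apply: le_trans (H1delta_le_H1 _ d0).
  apply: le_ereal_inf_tmp => _ [E [cov mesh ->]].
  apply: (@le_trans _ _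
    ((\sum_(i <oo) ediam (E i `&` A)) + (\sum_(i <oo) ediam (E i `&` B)))%E).
    apply: leeD; apply: H1delta_le_cover => [x hx|i].
    - by have [|i _ Ei] := cov x; [left|exists i].
    - by apply: le_trans (mesh i); apply: le_ediam => x [].
    - by have [|i _ Ei] := cov x; [right|exists i].
    - by apply: le_trans (mesh i); apply: le_ediam => x [].
  rewrite -nneseriesD; try by move=> i _ _; exact: ediam_ge0.
  apply: lee_nneseries => [i _ _|i _]; first by rewrite adde_ge0 ?ediam_ge0.
  have [[x [Ex Ax]]|nA] := pselect (exists x, E i x /\ A x).
    suff -> : E i `&` B = set0.
      by rewrite ediam_set0 adde0; apply: le_ediam => z [].
    apply/seteqP; split => // y [Ey By]; exfalso.
    have := le_trans (edist_le_ediam Ex Ey) (mesh i); rewrite lee_fin.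
    by have := sep x y Ax By; lra.
  have -> : E i `&` A = set0.
    by apply/seteqP; split => // x h; apply: nA; exists x.
  by rewrite ediam_set0 add0e; apply: le_ediam => z [].
have [d1 [d10 d1m]] : exists d, 0 < d /\ d < m by exists (m / 2); lra.
have [->|AB] := eqVneq (H1 (A `|` B)) +oo%E; first exact: leey.
have finU : H1 (A `|` B) \is a fin_num by rewrite ge0_fin_numE ?H1_ge0 // ltey.
(* Passing to a common small mesh decouples the two meshes. The two suprema can then be taken one at
   a time, subtracting the other term, which is finite. *)
have step (d d' : R) : 0 < d -> 0 < d' ->
    (H1delta d A + H1delta d' B <= H1 (A `|` B))%E.
  move=> d0 d'0; pose e := Num.min d (Num.min d' d1).
  have e0 : 0 < e by rewrite !lt_min d0 d'0 d10.
  apply: le_trans (key e e0 _); last by rewrite !gt_min d1m !orbT.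
  by apply: leeD; apply: le_H1delta_mesh; rewrite !ge_min lexx ?orbT.
have leB d' : 0 < d' -> (H1delta d' B <= H1 (A `|` B))%E.
  by move=> d'0; apply: le_trans (step 1 d' ltr01 d'0); rewrite leeDr ?H1delta_ge0.
have finB d' : 0 < d' -> H1delta d' B \is a fin_num.
  by move=> d'0; rewrite ge0_fin_numE ?H1delta_ge0 // (le_lt_trans (leB _ d'0)) // ltey.
have leA d' : 0 < d' -> (H1 A <= H1 (A `|` B) - H1delta d' B)%E.
  by move=> d'0; apply: H1_le => d d0; rewrite leeBrDr ?finB ?step.
have finA : H1 A \is a fin_num.
  rewrite ge0_fin_numE ?H1_ge0 //; apply: le_lt_trans (leA 1 ltr01) _.
  by rewrite ltey_eq fin_numB finU finB.
rewrite addeC -leeBrDr //; apply: H1_le => d d0.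
by rewrite leeBrDr // addeC -leeBrDr ?finB // leA.
Qed.

(* The distance to one end point is a contraction mapping the arc onto a
   segment of length the distance of its end points. *)
Lemma edist_le_H1 (f : R -> V) (a b : R) : a <= b -> continuous f ->
  ((edist (f a) (f b))%:E <= H1 (f @` `[a, b]))%E.
Proof.
move=> ab cf; apply: le_trans (H1delta_le_H1 _ ltr01).
apply: le_ereal_inf_tmp => _ [E [cov mesh ->]].
pose h u := edist (f a) (f u).
have ch : continuous h.
  by apply: continuous_edist cf => t; exact: cvg_cst.
pose I i := [set y | exists2 x, E i x & y = edist (f a) x].
pose d i := fine (ediam (E i)).
have dE i : (d i)%:E = ediam (E i).
  by rewrite /d fineK // ge0_fin_numE ?ediam_ge0 // (le_lt_trans (mesh i)) // ltey.
have d0 i : 0 <= d i by rewrite -lee_fin dE ediam_ge0.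
pose J i : set R := `[inf (I i), inf (I i) + d i]%classic.
have IJ i : I i `<=` J i.
  move=> _ [x Ex ->]; rewrite /J /= in_itv /=.
  have lbI : lbound (I i) 0 by move=> _ [z Ez ->]; exact: edist_ge0.
  apply/andP; split.
    by apply: ge_inf; [exists 0|exists x].
  rewrite -lerBlDr; apply: lb_le_inf; first by exists (edist (f a) x); exists x.
  move=> _ [z Ez ->]; rewrite lerBlDr.
  have : edist x z <= d i by rewrite -lee_fin dE; exact: edist_le_ediam.
  have := edist_triangle z (f a) x; rewrite (edistC z x); lra.
pose S : set R := `[0, edist (f a) (f b)]%classic.
have sub : S `<=` \bigcup_i J i.
  move=> y; rewrite /S /= in_itv /= => y01.
  have [|u uab hu] := @IVT _ h a b y ab (continuous_subspaceT ch).
    by rewrite /h edistxx ge_min le_max; case/andP: y01 => -> ->; rewrite orbT.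
  have [|i _ Ei] := cov (f u); first by exists u.
  by exists i => //; apply: IJ; exists (f u).
(* The problem is now on the line: countably many intervals, of lengths equal to the diameters,
   cover a segment. *)
have leb : (lebesgue_measure S <=
    \sum_(i <oo) lebesgue_measure (J i))%E.
  apply: (@measure_sigma_subadditive _ _ _ lebesgue_measure _ J _ _ sub) => [i|];
    exact: measurable_itv.
move: leb; rewrite lebesgue_measure_itv /= lte_fin => leb.
apply: (@le_trans _ _ (\sum_(i <oo) lebesgue_measure (J i))%E).
  apply: le_trans leb; case: ltP => [_|]; first by rewrite oppr0 adde0.
  by rewrite lee_fin.
apply: lee_nneseries => [i _ _|i _]; first by [].
rewrite lebesgue_measure_itv /= lte_fin -dE; case: ifP => _; last by rewrite lee_fin.
by rewrite -EFinB lee_fin; lra.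
Qed.

(** Required on the whole line; maps that matter on [[0, 1]] are extended by [clamp01]. *)
Definition lipschitz_with (K : R) (f : R -> V) :=
  forall s t, edist (f s) (f t) <= K * `|s - t|.

Lemma lipschitz_with_continuous (K : R) (f : R -> V) :
  lipschitz_with K f -> continuous f.
Proof.
move=> lf t; apply/cvg_ballP => e e0.
have K1 : 0 < `|K| + 1 by have := normr_ge0 K; lra.
near=> u; split => // i j; rewrite (ord1 i) /ball /=.
apply: le_lt_trans (coord_le_edist _ _ _) _; apply: le_lt_trans (lf _ _) _.
apply: (@le_lt_trans _ _ ((`|K| + 1) * `|t - u|)).
  by apply: ler_wpM2r; rewrite ?normr_ge0 //; have := ler_norm K; lra.
rewrite -ltr_pdivlMl //.
by near: u; apply: (nbhsx_ballx t); rewrite mulr_gt0 ?invr_gt0.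
Unshelve. all: by end_near. Qed.

(** Both parameter intervals are cut into [N] equal pieces whose images are smaller than the mesh.
    Treating two arcs together spares a separate proof that [H1] is subadditive: the uniqueness
    proof needs two arcs of one map, and later one arc of each of two maps. *)
Lemma H1_two_arcs (K : R) (f g : R -> V) (a b c d : R) A :
  0 <= K -> lipschitz_with K f -> lipschitz_with K g -> a <= b -> c <= d ->
  A `<=` (f @` `[a, b]) `|` (g @` `[c, d]) ->
  (H1 A <= (K * ((b - a) + (d - c)))%:E)%E.
Proof.
move=> K0 lf lg ab cd sub; apply: H1_le => e e0.
have [N N0 hN] : exists2 N, (0 < N)%N & K * (b - a) + K * (d - c) <= e * N%:R.
  exists (Num.trunc ((K * (b - a) + K * (d - c)) / e)).+1 => //.
  rewrite -ler_pdivrMl // mulrC; apply: ltW; exact: truncnS_gt.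
have NR : 0 < N%:R :> R by rewrite ltr0n.
pose piece (h : R -> V) (u v : R) i :=
  h @` `[u + i%:R * ((v - u) / N%:R), u + i.+1%:R * ((v - u) / N%:R)].
have piece_diam h u v i : lipschitz_with K h -> u <= v ->
    (ediam (piece h u v i) <= (K * (v - u) / N%:R)%:E)%E.
  move=> lh uv; apply: ediam_le.
    by rewrite divr_ge0 ?mulr_ge0 ?subr_ge0 // ltW.
  move=> _ _ [s hs <-] [t ht <-]; apply: le_trans (lh _ _) _.
  rewrite -mulrA; apply: ler_wpM2l => //.
  move: hs ht; rewrite /= !in_itv /= ler_norml -natr1.
  by rewrite (mulrDl _ _ (_ / _)) mul1r; lra.
have piece_cov h u v : u <= v -> h @` `[u, v] `<=` \bigcup_(i in `I_N) piece h u v i.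
  move=> uv _ [t + <-]; rewrite /= in_itv /= => /andP [ut tv].
  have [uv'|uv'] := leP v u.
    exists 0%N => //; exists t => //; rewrite /= in_itv /=.
    have -> : v = u by lra.
    by rewrite subrr !(mul0r, mulr0) addr0; apply/andP; split; lra.
  pose x := (t - u) / ((v - u) / N%:R).
  have w0 : 0 < (v - u) / N%:R by rewrite divr_gt0 // subr_gt0.
  have x0 : 0 <= x by rewrite divr_ge0 ?subr_ge0 // ltW.
  have tE : t = u + x * ((v - u) / N%:R) by rewrite divfK ?gt_eqF //; lra.
  have xN : x <= N%:R.
    by rewrite ler_pdivrMr // mulrC divfK ?gt_eqF //; lra.
  have [xlt|xge] := ltP x N%:R.
    exists (Num.trunc x); first by rewrite /= -(ltr_nat R) (le_lt_trans _ xlt) // truncn_le.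
    exists t => //; rewrite /= in_itv /= tE !lerD2l !ler_pM2r //.
    by have /andP [-> /ltW ->] := truncn_itv x0.
  (* At the right end point [x = N] truncation would give [N], one past the last piece. *)
  exists N.-1; first by rewrite /= prednK.
  exists t => //; rewrite /= in_itv /= tE !lerD2l !ler_pM2r //.
  rewrite prednK // xN andbT (le_trans _ xge) // ler_nat leq_pred //.
pose E i := if (i < N)%N then piece f a b i
            else if (i < N + N)%N then piece g c d (i - N)%N else set0.
have d1 : 0 <= K * (b - a) by rewrite mulr_ge0 // subr_ge0.
have d2 : 0 <= K * (d - c) by rewrite mulr_ge0 // subr_ge0.
apply: le_trans (@H1delta_le_cover e A E _ _) _.
- move=> x /sub [] /piece_cov => [/(_ ab) [i ltiN pi]|/(_ cd) [i ltiN pi]].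
    by exists i => //; rewrite /E ifT.
  by exists (i + N)%N => //; rewrite /E ltnNge leq_addl /= ltn_add2r ifT ?addnK.
- move=> i; rewrite /E; case: ifP => _; last case: ifP => _.
  + apply: le_trans (piece_diam _ _ _ _ lf ab) _.
    by rewrite lee_fin ler_pdivrMr //; lra.
  + apply: le_trans (piece_diam _ _ _ _ lg cd) _.
    by rewrite lee_fin ler_pdivrMr //; lra.
  + by rewrite ediam_set0 lee_fin ltW.
rewrite (@nneseries_split _ _ 0%N (N + N)%N); last by move=> *; exact: ediam_ge0.
rewrite [X in (_ + X)%E]eseries0 ?adde0; last first.
  move=> i; rewrite /= add0n => le _; rewrite /E !ifF ?ediam_set0 //.
    by apply/negbTE; rewrite -leqNgt.
  by apply/negbTE; rewrite -leqNgt; apply: leq_trans le; exact: leq_addr.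
rewrite add0n (@big_cat_nat _ _ _ N) ?leq_addr //=.
have -> : K * (b - a + (d - c)) =
    \sum_(0 <= i < N) (K * (b - a) / N%:R) + \sum_(N <= i < N + N) (K * (d - c) / N%:R).
  have divnK (x : R) : x / N%:R *+ N = x.
    by rewrite -(mulr_natr (x / _)) divfK ?gt_eqF.
  by rewrite !sumr_const_nat addnK subn0 !divnK mulrDr.
rewrite EFinD -!sumEFin; apply: leeD.
  rewrite !big_mkord; apply: lee_sum => i _; rewrite /E ltn_ord.
  exact: piece_diam.
rewrite big_nat_cond [leRHS]big_nat_cond.
apply: lee_sum => i /andP [/andP [le lt] _]; rewrite /E ltnNge le /= lt.
exact: piece_diam.
Qed.

End HausdorffMeasure.

(** * Uniqueness of Lipschitz parametrizations *)

Section ArcLength.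
Context {R : realType} {n : nat}.
Local Notation V := 'rV[R]_n.

Definition clamp01 (t : R) : R := Num.max 0 (Num.min 1 t).

Lemma clamp01E t : clamp01 t = if t <= 0 then 0 else if t <= 1 then t else 1.
Proof.
by rewrite /clamp01; case: (leP t 1) => t1; case: (leP t 0) => t0 //;
  rewrite ?max_r //; lra.
Qed.

Lemma clamp01_itv t : 0 <= clamp01 t <= 1.
Proof. by rewrite clamp01E; case: (leP t 0) => t0; case: (leP t 1) => t1; lra. Qed.

Lemma clamp01_id t : 0 <= t <= 1 -> clamp01 t = t.
Proof. by rewrite clamp01E => h; case: (leP t 0) => t0; case: (leP t 1) => t1; lra. Qed.

Lemma clamp01_lip s t : `|clamp01 s - clamp01 t| <= `|s - t|.
Proof.
have st0 := ler_norm (s - t); have ts0 := lerNnormlW (lexx `|s - t|).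
by rewrite !clamp01E ler_norml; case: (leP s 0) => s0; case: (leP s 1) => s1;
  case: (leP t 0) => t0; case: (leP t 1) => t1; lra.
Qed.

Lemma continuous_clamp01 : continuous clamp01.
Proof.
move=> t; apply/cvgrPdist_lt => e e0; near=> u.
apply: le_lt_trans (clamp01_lip _ _) _.
by near: u; apply: (nbhsx_ballx t).
Unshelve. all: by end_near. Qed.

Lemma continuous_extension01 (T : topologicalType) (f : R -> T) :
  {within `[0, 1], continuous f} -> continuous (f \o clamp01).
Proof.
move=> cf t.
have c01 : `[0, 1]%classic (clamp01 t) by rewrite /= in_itv /= clamp01_itv.
have h : f @ within `[0, 1] (nbhs (clamp01 t)) --> f (clamp01 t).
  by rewrite (nbhs_subspace_in c01); exact: (cf (clamp01 t)).
apply: cvg_comp h => B; rewrite /within /= => hB.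
apply: (@filterS _ (nbhs t) _ (clamp01 @^-1` [set y | `[0, 1]%classic y -> B y])).
  by move=> u; apply; rewrite /= in_itv /= clamp01_itv.
exact: (@continuous_clamp01 t _ hB).
Qed.

Lemma image_extension01 (f : R -> V) (a b : R) : 0 <= a -> b <= 1 ->
  (f \o clamp01) @` `[a, b] = f @` `[a, b].
Proof.
by move=> a0 b1; apply/seteqP; split => _ [t tab <-]; exists t => //=;
  rewrite clamp01_id //; move: tab; rewrite /= in_itv /=; lra.
Qed.

Lemma point_arc_separated (f : R -> V) (p q : R) y : p <= q -> continuous f ->
  ~ (f @` `[p, q]) y ->
  exists2 m, 0 < m & forall u, p <= u <= q -> m <= edist y (f u).
Proof.
move=> pq cf ny.
have ch : continuous (fun u => edist y (f u)).
  by apply: continuous_edist cf => t; exact: cvg_cst.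
have [c cpq hc] := EVT_min pq (continuous_subspaceT ch).
exists (edist y (f c)) => [|u upq]; last by apply: hc; rewrite in_itv.
rewrite lt_neqAle edist_ge0 andbT eq_sym; apply/eqP => /edist_eq0 e.
by apply: ny; exists c.
Qed.

Lemma arcs_separated (f : R -> V) (p q p' q' : R) : p <= q -> p' <= q' ->
  continuous f -> (forall u v, p <= u <= q -> p' <= v <= q' -> f u <> f v) ->
  exists2 m, 0 < m &
    forall u v, p <= u <= q -> p' <= v <= q' -> m <= edist (f u) (f v).
Proof.
move=> pq pq' cf ne.
pose h (z : R * R) := edist (f z.1) (f z.2).
have ch : continuous h.
  apply: continuous_edist => z; apply: continuous_comp => //.
  - exact: cvg_fst.
  - exact: cf.
  - exact: cvg_snd.
  - exact: cf.
have c2 := compact_setX (@segment_compact R p q) (@segment_compact R p' q').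
have [|c] := compact_EVT_min _ c2 (continuous_subspaceT ch).
  by exists (p, p'); split; rewrite /= in_itv /= lexx.
rewrite inE => -[/= c1 c3] hc; exists (h c) => [|u v upq vpq]; last first.
  by apply: (hc (u, v)); rewrite inE; split; rewrite /= in_itv.
rewrite lt_neqAle edist_ge0 andbT eq_sym; apply/eqP => /edist_eq0.
by apply: ne; [move: c1|move: c3]; rewrite in_itv.
Qed.

Variables (g : R -> V) (L : R).
Hypothesis cg : continuous g.
Hypothesis inj_g : forall s t, 0 <= s <= 1 -> 0 <= t <= 1 -> g s = g t -> s = t.
Hypothesis len_g : forall t, 0 <= t <= 1 -> H1 (g @` `[0, t]) = (t * L)%:E.

Lemma arclength_gt0 : 0 < L.
Proof.
have := edist_le_H1 ler01 cg; rewrite len_g ?lexx ?ler01 // mul1r lee_fin.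
apply: lt_le_trans; rewrite lt_neqAle edist_ge0 andbT eq_sym.
by apply/eqP => /edist_eq0 /inj_g; rewrite !lexx !ler01 => /(_ isT isT) /eqP;
  rewrite eq_sym oner_eq0.
Qed.

(** Only the lengths of initial arcs are given. The arcs over [[0, s - e]] and [[s, t]] are compact
    and disjoint, hence a positive distance apart, so their measures add up to at most [t * L]. This
    leaves [L * (t - s + e)] for the second one, and [e] tends to 0. *)
Lemma arclength_lip s t : 0 <= s -> s <= t -> t <= 1 ->
  edist (g s) (g t) <= L * (t - s).
Proof.
move=> s0 st t1; have L0 := arclength_gt0.
have := edist_le_H1 st cg.
move: s0; rewrite le_eqVlt => /orP [/eqP s0|s0].
  by subst s; rewrite len_g ?lee_fin; [rewrite subr0 mulrC|lra].
move=> hd; suff h e : 0 < e -> e < s -> edist (g s) (g t) <= L * (t - s + e).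
  rewrite leNgt; apply/negP => lt.
  pose e0 := (edist (g s) (g t) - L * (t - s)) / (2 * L).
  have e00 : 0 < e0 by rewrite divr_gt0 ?mulr_gt0 ?subr_gt0.
  have eL : L * e0 = (edist (g s) (g t) - L * (t - s)) / 2.
    by rewrite /e0; field; rewrite gt_eqF.
  pose e := Num.min e0 (s / 2).
  have ee0 : e <= e0 by rewrite ge_min lexx.
  have es : e <= s / 2 by rewrite ge_min lexx orbT.
  have := h e; rewrite lt_min e00 divr_gt0 // => /(_ isT).
  have : L * e <= L * e0 by apply: ler_wpM2l => //; exact: ltW.
  by rewrite mulrDr; lra.
move=> e0 es.
have [m m0 hm] : exists2 m, 0 < m &
    forall u v, 0 <= u <= s - e -> s <= v <= t -> m <= edist (g u) (g v).
  apply: arcs_separated => //; first by lra.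
  by move=> u v hu hv guv; have : u = v; [apply: inj_g => //; lra|lra].
pose A := g @` `[0, s - e]; pose B := g @` `[s, t]; pose G := g @` `[0, t].
have hA : H1 A = ((s - e) * L)%:E by apply: len_g; lra.
have hG : H1 G = (t * L)%:E by apply: len_g; lra.
have hAB : (H1 A + H1 B <= H1 (A `|` B))%E.
  apply: (H1_separated m0) => _ _ [u + <-] [v + <-].
  by rewrite /= !in_itv /=; exact: hm.
have hU : (H1 (A `|` B) <= H1 G)%E.
  apply: le_H1 => _ [[u + <-]|[u + <-]]; rewrite /= in_itv /= => hu;
    exists u => //; rewrite /= in_itv /=; lra.
have : (((s - e) * L)%:E + (edist (g s) (g t))%:E <= (t * L)%:E)%E.
  rewrite -hG -hA; apply: le_trans hU; apply: le_trans hAB.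
  by rewrite leeD2l.
by rewrite -EFinD lee_fin; lra.
Qed.

Lemma arclength_total (A : set V) : g @` `[0, 1] `<=` A -> (L%:E <= H1 A)%E.
Proof. by move=> /le_H1; rewrite len_g ?mul1r // lexx ler01. Qed.

(** * Maps with the optimal Lipschitz constant that cover the curve *)

Section Unique.
Variable f : R -> V.
Hypothesis g_clamp : forall t, g (clamp01 t) = g t.
Hypothesis lip_f : lipschitz_with L f.
Hypothesis f_onto : g @` `[0, 1] `<=` f @` `[0, 1].

Lemma arclength_lipschitz : lipschitz_with L g.
Proof.
have L0 := ltW arclength_gt0.
move=> s t; rewrite -(g_clamp s) -(g_clamp t).
apply: (@le_trans _ _ (L * `|clamp01 s - clamp01 t|)); last first.
  by apply: ler_wpM2l => //; exact: clamp01_lip.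
have := clamp01_itv s; have := clamp01_itv t.
move: (clamp01 s) (clamp01 t) => {}s {}t ht hs.
wlog st : s t hs ht / s <= t.
  move=> h; case: (leP s t) => [|/ltW] st; first exact: h.
  by rewrite edistC distrC; apply: h.
by rewrite ler0_norm ?opprB ?subr_le0 //; apply: arclength_lip; lra.
Qed.

(** If [f x] were off the curve, so would be [f] on an interval around [x]. The remaining parameters
    have total length below 1, too little for an [L]-Lipschitz map to cover a set of measure [L]. *)
Lemma cover_stays_inside x : 0 <= x <= 1 -> (g @` `[0, 1]) (f x).
Proof.
move=> x01; apply: contrapT => nx; have L0 := arclength_gt0.
have [m m0 hm] := point_arc_separated ler01 cg nx.
(* Within distance [e] of [x] the map [f] moves by at most [m / 2], so it cannot reach the curve. *)
pose e := m / (2 * L).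
have e0 : 0 < e by rewrite divr_gt0 // mulr_gt0.
have eL : L * e = m / 2 by rewrite /e; field; rewrite gt_eqF.
pose a := Num.max 0 (x - e); pose b := Num.min 1 (x + e).
have a0 : 0 <= a by rewrite le_max lexx.
have ax : a <= x by rewrite ge_max; lra.
have b1 : b <= 1 by rewrite ge_min lexx.
have xb : x <= b by rewrite le_min; lra.
have sub : g @` `[0, 1] `<=` (f @` `[0, a]) `|` (f @` `[b, 1]).
  move=> y gy; have [u + fu] := f_onto gy; rewrite /= in_itv /= => u01.
  case: (leP u a) => [ua|au].
    by left; exists u => //; rewrite /= in_itv /= ua; lra.
  case: (leP b u) => [bu|ub].
    by right; exists u => //; rewrite /= in_itv /= bu; lra.
  exfalso; move: gy => [v + gv]; rewrite /= in_itv /= => v01.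
  have := hm v v01; rewrite gv -fu => h.
  have : L * `|x - u| <= L * e.
    apply: ler_wpM2l; first exact: ltW.
    move: au ub; rewrite gt_max lt_min ler_norml; lra.
  by have := lip_f x u; lra.
have := le_trans (arclength_total (fun x h => h)) (H1_two_arcs (ltW L0) lip_f lip_f a0 b1 sub).
rewrite lee_fin -subr_ge0.
have -> : L * (a - 0 + (1 - b)) - L = L * (a - b) by ring.
rewrite pmulr_rge0 // /a /b; case: (leP 0 (x - e)) => h1; case: (leP 1 (x + e)) => h2; lra.
Qed.

(** Connectedness. If [f] missed [g c] on [[s, t]], the preimages of the two closed subarcs of [g]
    that meet at [g c] would be disjoint, closed and would cover [[s, t]], yet one end point of
    [[s, t]] goes to [g a] and the other to [g b], on either side of [g c]. *)
Lemma arc_in_image s t a b : 0 <= s -> s <= t -> t <= 1 ->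
  0 <= a -> a <= b -> b <= 1 ->
  (f s = g a /\ f t = g b) \/ (f s = g b /\ f t = g a) ->
  g @` `[a, b] `<=` f @` `[s, t].
Proof.
move=> s0 st t1 a0 ab b1 ends _ [c + <-]; rewrite /= in_itv /= => cab.
apply: contrapT => nc.
have cf := lipschitz_with_continuous lip_f.
have closed_pre p q : p <= q -> closed (f @^-1` (g @` `[p, q])).
  move=> pq; rewrite -openC openE => x /= nx; rewrite /interior.
  have [m m0 hm] := point_arc_separated pq cg nx.
  have ch : continuous (fun u => edist (f x) (f u)).
    by apply: continuous_edist cf => ?; exact: cvg_cst.
  have /cvgr_lt /(_ m) := ch x; rewrite edistxx => /(_ m0).
  apply: filterS => u hu [v + gv]; rewrite /= in_itv /= => vpq.
  by have := hm v vpq; rewrite gv leNgt hu.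
pose B := `[s, t] `&` f @^-1` (g @` `[0, c]).
have BE : B = `[s, t]%classic.
  apply: (@segment_connected _ s t) => /=.
  - case: ends => -[e1 e2]; [exists s|exists t]; split => //=;
      rewrite ?in_itv /= ?lexx ?st //.
    + by exists a => //; rewrite /= in_itv /=; lra.
    + by exists a => //; rewrite /= in_itv /=; lra.
  - exists (~` (f @^-1` (g @` `[c, 1]))).
      by rewrite openC; apply: closed_pre; lra.
    apply/seteqP; split => u [ust]; rewrite /= => h; split => //.
    + move=> [v' + e']; case: h => v + e; rewrite /= !in_itv /= => hv hv'.
      have vv : v = v' by apply: inj_g; [lra|lra|rewrite e e'].
      apply: nc; exists u => //; rewrite -e; congr g; lra.
    + have [|v + e] := @cover_stays_inside u.
        by move: ust; rewrite /= in_itv /=; lra.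
      rewrite /= in_itv /= => hv; exists v => //; rewrite /= in_itv /=.
      apply/andP; split; first by lra.
      rewrite leNgt; apply/negP => cv; apply: h; exists v => //.
      by rewrite /= in_itv /=; lra.
  - by exists (f @^-1` (g @` `[0, c])) => //; apply: closed_pre; lra.
have [x xst fx] : exists2 x, `[s, t]%classic x & f x = g b.
  by case: ends => -[e1 e2]; [exists t|exists s] => //; rewrite /= in_itv /= lexx st.
have : B x by rewrite BE.
move=> [_ [v + e]]; rewrite /= in_itv /= => hv.
(* Now [b = v <= c <= b], so [g c] is the value [g b], which [f] does attain. *)
have vb : v = b by apply: inj_g; [lra|lra|rewrite e].
apply: nc; exists x => //; rewrite fx; congr g; lra.
Qed.

(** The initial arc up to [g b], of length [b * L], is covered by the one up to [g a] together with
    the image of [[s, t]], whose measure is at most [L * (t - s)]. *)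
Lemma arclength_monotone s t a b : 0 <= s -> s <= t -> t <= 1 ->
  0 <= a <= 1 -> 0 <= b <= 1 ->
  (f s = g a /\ f t = g b) \/ (f s = g b /\ f t = g a) -> b - a <= t - s.
Proof.
move=> s0 st t1 a01 b01 ends; have L0 := arclength_gt0.
case: (leP a b) => [ab|]; last by lra.
have sub : g @` `[0, b] `<=` (g @` `[0, a]) `|` (f @` `[s, t]).
  move=> _ [u + <-]; rewrite /= in_itv /= => ub.
  case: (leP u a) => ua.
    by left; exists u => //; rewrite /= in_itv /=; lra.
  right; apply: (arc_in_image _ _ _ _ ab _ ends) => //; try lra.
  by exists u => //; rewrite /= in_itv /=; lra.
have /andP [a0 _] := a01.
have := H1_two_arcs (ltW L0) arclength_lipschitz lip_f a0 st sub.
rewrite len_g // lee_fin mulrC ler_pM2l //; lra.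
Qed.

(** Parameters that reach the two end points are at least 1 apart, so they are 0 and 1. The same
    bound applied on both sides of [t] then squeezes the position of [f t] from above and below. *)
Lemma lipschitz_param_unique :
  (forall t, 0 <= t <= 1 -> f t = g t) \/
  (forall t, 0 <= t <= 1 -> f t = g (1 - t)).
Proof.
have [u + fu] : (f @` `[0, 1]) (g 0).
  by apply: f_onto; exists 0 => //; rewrite /= in_itv /= lexx ler01.
have [v + fv] : (f @` `[0, 1]) (g 1).
  by apply: f_onto; exists 1 => //; rewrite /= in_itv /= lexx ler01.
rewrite /= !in_itv /= => v01 u01.
have z01 : 0 <= (0 : R) <= 1 by rewrite lexx ler01.
have o01 : 0 <= (1 : R) <= 1 by rewrite lexx ler01.
have inside t : 0 <= t <= 1 -> exists2 p, 0 <= p <= 1 & f t = g p.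
  by move=> /cover_stays_inside [p + <-]; rewrite /= in_itv /=; exists p.
case: (leP u v) => uv; [left|right] => t t01; have [p p01 ft] := inside t t01.
- have : 1 - 0 <= v - u by apply: arclength_monotone => //; [lra|lra|left].
  move=> h; have u0 : u = 0 by lra. have v1 : v = 1 by lra.
  subst u v.
  have h1 : p - 0 <= t - 0 by apply: arclength_monotone => //; [lra|lra|left].
  have h2 : 1 - p <= 1 - t by apply: arclength_monotone => //; [lra|lra|left].
  by rewrite ft; congr g; lra.
- have : 1 - 0 <= u - v by apply: arclength_monotone => //; [lra|lra|lra|right].
  move=> h; have u1 : u = 1 by lra. have v0 : v = 0 by lra.
  subst u v.
  have h1 : 1 - p <= t - 0 by apply: arclength_monotone => //; [lra|lra|right].
  have h2 : p - 0 <= 1 - t by apply: arclength_monotone => //; [lra|lra|right].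
  by rewrite ft; congr g; lra.
Qed.

End Unique.
End ArcLength.

(** * Rational codes and samples of a computable curve *)

Section Codes.
Context {R : realType}.

Lemma unzigK z : unzig (zig z) = z.
Proof.
case: z => m; rewrite /unzig /zig /= odd_double /=; first by rewrite doubleK.
by rewrite ?doubleK NegzE.
Qed.

Lemma encqK q : decq (encq q) = q.
Proof.
rewrite /decq /encq nunpairK /= unzigK.
by rewrite [_.+1%:R]pmulrn prednK ?absz_gt0 ?denq_neq0 // gez0_abs ?divq_num_den // ltW.
Qed.

(* The rational coded by [w], shifted by [A] and scaled by [2^k], is rounded
   towards [A * 2^k]; truncated subtraction replaces negative results by 0. *)
Definition fixpt (A k w : nat) : nat :=
  let M := (((nunpair w).1.+1)./2 * 2 ^ k %/ (nunpair w).2.+1)%N in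
  if odd (nunpair w).1 then (A * 2 ^ k - M)%N else (A * 2 ^ k + M)%N.

Lemma fixptP A k w :
  `|(fixpt A k w)%:R / 2 ^+ k - Num.max 0 (ratr (decq w) + A%:R)| <= (2 ^+ k)^-1 :> R.
Proof.
rewrite /fixpt /decq; case: (nunpair w) => m d /=.
set N := (_ * _)%N; set M := (_ %/ _)%N.
have K0 : 0 < 2 ^+ k :> R by rewrite exprn_gt0.
have D0 : 0 < d.+1%:R :> R by rewrite ltr0n.
have hM1 : M%:R * d.+1%:R <= m.+1./2%:R * 2 ^+ k :> R.
  by rewrite -natrX -!natrM ler_nat leq_trunc_div.
have hM2 : m.+1./2%:R * 2 ^+ k < (M%:R + 1) * d.+1%:R :> R.
  by rewrite natr1 -natrX -!natrM ltr_nat ltn_ceil.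
have e1 : 1 / 2 ^+ k = (2 ^+ k)^-1 :> R by rewrite mul1r.
pose y : R := m.+1./2%:R / d.+1%:R.
have y1 : M%:R / 2 ^+ k <= y.
  by rewrite /y ler_pdivrMr // mulrAC ler_pdivlMr.
have y2 : y < M%:R / 2 ^+ k + (2 ^+ k)^-1.
  by rewrite -[X in _ + X]mul1r -mulrDl /y ltr_pdivlMr // mulrAC ltr_pdivrMr.
have M0 : 0 <= M%:R / 2 ^+ k :> R by rewrite divr_ge0 // ltW.
have A2 : (A * 2 ^ k)%:R / 2 ^+ k = A%:R :> R.
  by rewrite natrM natrX mulfK ?gt_eqF.
have A0 : 0 <= A%:R :> R by [].
case: ifP => om.
- have -> : ratr ((unzig m)%:~R / d.+1%:R) + A%:R = A%:R - y :> R.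
    rewrite /unzig om fmorph_div /= ratr_int ratr_nat mulrNz mulNr addrC.
    by [].
  have [le|lt] := leqP (A * 2 ^ k) M.
    have -> : (A * 2 ^ k - M)%N = 0%N by lia.
    have : (A * 2 ^ k)%:R / 2 ^+ k <= M%:R / 2 ^+ k :> R.
      by rewrite ler_pM2r ?invr_gt0 // ler_nat.
    rewrite A2 mul0r sub0r normrN => h; rewrite max_l ?normr0 ?invr_ge0 ?(ltW K0) //; lra.
  rewrite natrB ?mulrBl ?A2; last exact: ltnW.
  have : (M%:R + 1) / 2 ^+ k <= (A * 2 ^ k)%:R / 2 ^+ k :> R.
    by rewrite ler_pM2r ?invr_gt0 // natr1 ler_nat.
  rewrite A2 mulrDl mul1r => h; rewrite ler_norml.
  by case: (leP 0 (A%:R - y)); lra.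
- have -> : ratr ((unzig m)%:~R / d.+1%:R) + A%:R = A%:R + y :> R.
    rewrite /unzig om fmorph_div /= ratr_int ratr_nat addrC /y.
    by rewrite -uphalfE uphalf_half om.
  have y0 : 0 <= y by lra.
  rewrite max_r ?addr_ge0 // natrD mulrDl A2 ler_norml; lra.
Qed.

(** The odd numerator puts the fraction in lowest terms, so its code is given by a formula without
    any gcd. The remainder keeps it in [[0, 1]] for every [b]. *)
Definition sample (b m : nat) : rat := ((b %% 2 ^ m).*2.+1)%:R / 2 ^+ m.+1.

Lemma encq_sample b m :
  encq (sample b m) = npair ((b %% 2 ^ m).*2.+1).*2 (2 ^ m.+1).-1.
Proof.
rewrite /sample /encq; set a := (b %% 2 ^ m)%N.
have co : coprime `|(a.*2.+1)%:Z|%N `|(2 ^ m.+1)%:Z|%N.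
  by rewrite /= coprime_sym coprimeXl // coprime2n /= odd_double.
have -> : (a.*2.+1)%:R / 2 ^+ m.+1 = (a.*2.+1)%:Z%:~R / (2 ^ m.+1)%:Z%:~R :> rat.
  by rewrite -!pmulrn natrX.
rewrite coprimeq_num // coprimeq_den //.
have -> : (2 ^ m.+1)%:Z == 0 = false by rewrite eqz_nat expn_eq0.
by rewrite gtr0_sg ?mul1r //= ltz_nat expn_gt0.
Qed.

Lemma sample_itv b m : 0 <= (ratr (sample b m) : R) <= 1.
Proof.
have P0 : 0 < 2 ^+ m.+1 :> R by rewrite exprn_gt0.
rewrite /sample fmorph_div rmorphXn /= !rmorph_nat.
apply/andP; split; first by rewrite divr_ge0 // ltW.
rewrite ler_pdivrMr // mul1r -natrX ler_nat expnS.
by have := ltn_pmod b (expn_gt0 2 m); lia.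
Qed.

Lemma sample_dense (t : R) N : 0 <= t <= 1 ->
  exists2 b, (b < 2 ^ N)%N & `|ratr (sample b N) - t| <= (2 ^+ N)^-1.
Proof.
move=> /andP [t0 t1]; have P0 : 0 < 2 ^+ N :> R by rewrite exprn_gt0.
have tP0 : 0 <= t * 2 ^+ N by rewrite mulr_ge0 // ltW.
have PN : (0 < 2 ^ N)%N by rewrite expn_gt0.
(* The cap matters at [t = 1]. *)
pose b := minn (Num.trunc (t * 2 ^+ N)) (2 ^ N).-1.
have bN : (b < 2 ^ N)%N by rewrite /b; lia.
exists b => //.
have sE : ratr (sample b N) = (b%:R + 2^-1) / 2 ^+ N :> R.
  rewrite /sample fmorph_div rmorphXn /= !rmorph_nat modn_small // exprS.
  by rewrite -natr1 -muln2 natrM; field; rewrite gt_eqF.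
have h : b%:R <= t * 2 ^+ N <= b%:R + 1.
  have /andP [h1 h2] := truncn_itv tP0.
  rewrite /b; have [le|lt] := leqP (Num.trunc (t * 2 ^+ N)) (2 ^ N).-1.
    by rewrite h1 natr1 ltW.
  rewrite (le_trans _ h1) ?ler_nat ?(ltnW lt) //=.
  rewrite natr1 prednK // natrX; apply: (le_trans (ler_wpM2r (ltW P0) t1)).
  by rewrite mul1r.
have -> : ratr (sample b N) - t = (b%:R + 2^-1 - t * 2 ^+ N) / 2 ^+ N.
  by rewrite sE; field; rewrite gt_eqF.
rewrite normrM (@ger0_norm _ (_ ^-1)) ?invr_ge0 ?(ltW P0) //.
by rewrite -[leRHS]mul1r ler_pM2r ?invr_gt0 // ler_norml; lra.
Qed.

End Codes.

(** * Dyadic samples and continuity of a computable function *)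

Section Samples.
Context {R : realType} {n : nat}.
Variable f : R -> 'rV[R]_n.
Hypothesis cf : computable f.

(** The sample point is rational, so the oracle that always answers with it is exact at every
    precision, and [param_orc] makes its code an ordinary argument. [choice] merely names the
    outputs of the resulting program. *)
Lemma computable_sample ol : exists P : nat -> nat -> nat -> nat,
  rec3 ol P /\ forall b m r,
    edist (map_mx ratr (decpt n (P b m r))) (f (ratr (sample b m)))
      <= (2 ^+ r)^-1.
Proof.
have [M hM] := cf.
have /choice [P hP] : forall x : nat * nat * nat, exists k,
    eval [:: fun _ => encq (sample x.1.1 x.1.2)] M [:: x.2] k /\
    edist (map_mx ratr (decpt n k)) (f (ratr (sample x.1.1 x.1.2)))
      <= (2 ^+ x.2)^-1.
  move=> [[b m] r] /=; have [|k hk] := hM _ (sample_itv b m) (fun _ => sample b m) _ r.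
    by move=> s; rewrite subrr normr0 invr_ge0 exprn_ge0.
  by exists k.
exists (fun b m r => P (b, m, r)); split; last by move=> b m r; case: (hP (b, m, r)).
apply: rec3I.
have hP3 : recf ol 2 (fun xs => encq (sample (nth 0%N xs 0) (nth 0%N xs 1))).
  have := rec2_npair (ol := ol) (m := 2)
    (A := fun xs => (((nth 0%N xs 0) %% 2 ^ (nth 0%N xs 1)).*2.+1).*2%N)
    (B := fun xs => (2 ^ (nth 0%N xs 1).+1).-1%N).
  move=> h; apply: recf_ext (h _ _) => [xs _||]; first by rewrite encq_sample.
  - apply: rec1_double; apply: rec1_succ; apply: rec1_double.
    apply: rec2_mod; first exact: (recf_var _ 0).
    by apply: rec2_exp; [exact: recf_const|exact: (recf_var _ 0)].
  - apply: rec1_pred; apply: rec2_exp; first exact: recf_const.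
    by apply: rec1_succ; exact: (recf_var _ 0).
have [c hc] := @rec2I ol (fun b m => encq (sample b m)) hP3 _ _ _ (recf_var ol 0 0 3) (recf_var ol 0 1 3).
exists (CComp (param_orc M) [:: c; CProj 2]) => ot xs sx.
apply: (@ev_comp _ _ _ _ [:: encq (sample (nth 0%N xs 0) (nth 0%N xs 1)); nth 0%N xs 2]).
  constructor; first exact: hc.
  by constructor; [exact: ev_proj|constructor].
by case: (hP (nth 0%N xs 0, nth 0%N xs 1, nth 0%N xs 2)) => /param_orcP h _; apply: h.
Qed.

(* The computation at [t] inspects only finitely many oracle values, and these
   may also be given by an oracle for any nearby point. *)
Lemma computable_continuous (t : R) r : 0 <= t <= 1 ->
  exists N, forall q : rat, 0 <= (ratr q : R) <= 1 ->
    `|ratr q - t| <= (2 ^+ N)^-1 -> edist (f (ratr q)) (f t) <= 2 * (2 ^+ r)^-1.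
Proof.
move=> t01; have [M hM] := cf.
(* Twice the required accuracy, so that the first [N] answers remain valid for any [q] within
   [(2 ^+ N)^-1] of [t]. *)
have /choice [Ot hO] : forall s : nat, exists q : rat, `|ratr q - t| <= (2 ^+ s.+1)^-1.
  move=> s; have e0 : 0 < (2 ^+ s.+1)^-1 :> R by rewrite invr_gt0 exprn_gt0.
  have [|q] := @rat_in_itvoo R t (t + (2 ^+ s.+1)^-1); first by lra.
  by rewrite in_itv /= => hq; exists q; rewrite ler_norml; lra.
have hOt : is_oracle t Ot.
  move=> s; apply: le_trans (hO s) _; rewrite lef_pV2 ?posrE ?exprn_gt0 //.
  by rewrite ler_eXn2l // ltr1n.
have [k [ek dk]] := hM t t01 Ot hOt r.
have [N hN] := eval_finite_use ek.
exists N => q q01 qt.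
pose O' s := if (s < N)%N then Ot s else q.
have hO' : is_oracle (ratr q : R) O'.
  move=> s; rewrite /O'; case: (ltnP s N) => lt; last first.
    by rewrite subrr normr0 invr_ge0 exprn_ge0.
  have h1 := hO s.
  have h2 : (2 ^+ N)^-1 <= (2 ^+ s.+1)^-1 :> R.
    by rewrite lef_pV2 ?posrE ?exprn_gt0 // ler_eXn2l // ltr1n.
  have h3 : (2 ^+ s)^-1 = 2 * (2 ^+ s.+1)^-1 :> R.
    by rewrite exprS invfM mulrA mulfV ?mul1r.
  move: h1 qt; rewrite h3 !ler_norml; lra.
have [k' [ek' dk']] := hM (ratr q) q01 O' hO' r.
have kk' : k = k'.
  apply: eval_functional ek'; apply: hN => -[|j] i lt //=.
  by rewrite /O' lt.
subst k'.
by have := edist_triangle (map_mx ratr (decpt n k)) (f (ratr q)) (f t);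
  rewrite [X in _ <= X + _]edistC; lra.
Qed.

Lemma computable_sample_dense (t : R) (e : R) : 0 <= t <= 1 -> 0 < e ->
  exists b m, (b < 2 ^ m)%N /\ edist (f (ratr (sample b m))) (f t) <= e.
Proof.
move=> t01 e0.
have [r hr] : exists r, 2 * (2 ^+ r)^-1 <= e :> R.
  exists (Num.trunc (2 / e)).+1.
  rewrite ler_pdivrMr ?exprn_gt0 // mulrC -ler_pdivrMr //.
  apply: le_trans (ltW (truncnS_gt _)) _.
  by rewrite -natrX ler_nat ltnW // ltn_expl.
have [N hN] := computable_continuous r t01.
have [b bN hb] := sample_dense N t01.
exists b, N; split => //; apply: le_trans hr.
by apply: hN => //; exact: sample_itv.
Qed.

End Samples.

(** * The search for grid functions *)

Local Open Scope nat_scope.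

Section Program.
Variables (n A E beta : nat) (c0 : 'I_n) (ol : nat -> nat).
Variable P : nat -> nat -> nat -> nat.
Hypothesis rec_P : rec3 ol P.

Definition base k := 2 * A * 2 ^ k.

(* A number [s] codes a function from the grid points [0, ..., 2^k] to the
   grid of mesh [2^-k] in the cube [-A, A)^n by its digits in base [base k]. *)
Definition digit k s i c := (s %/ base k ^ (i * n + c)) %% base k.

Definition absdiff a b := (a - b) + (b - a).

Definition sqdist k s i s' i' :=
  \sum_(c < n) absdiff (digit k s i c) (digit k s' i' c) ^ 2.

(** Adding one unit for the oracle error and one for the rounding makes this an upper bound for the
    length, in units of [2^-k]. *)
Definition lengthpt k := fixpt 0 k (ol k) + 2.

Definition samplept k b m c := fixpt A k (nth 0 (decseq n (P b m k)) c).

(** The Lipschitz inequality with additive error [E * 2^-k], multiplied by [4^k] and squared so that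
    only natural numbers occur. *)
Definition lip_test k s :=
  [forall i : 'I_(2 ^ k).+1, [forall j : 'I_(2 ^ k).+1,
    4 ^ k * sqdist k s i s j <= (lengthpt k * absdiff i j + E * 2 ^ k) ^ 2]].

(** Each fixed sample is tested at all but finitely many levels, which is what the limit argument
    requires. *)
Definition cover_test k s :=
  [forall m : 'I_k, [forall b : 'I_(2 ^ m), [exists i : 'I_(2 ^ k).+1,
    \sum_(c < n) absdiff (digit k s i c) (samplept k b m c) ^ 2 <= E ^ 2]]].

(** The inequality is not strict because rounding may produce equality. The reversed curve is still
    excluded in the limit, since the coordinates of the end points of [gamma] differ strictly. *)
Definition direction_test k s :=
  digit k s (beta * 2 ^ k) c0 <= digit k s ((1 - beta) * 2 ^ k) c0.

Definition candidate k s := [&& lip_test k s, cover_test k s & direction_test k s].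

Definition code_bound k := base k ^ ((2 ^ k).+1 * n).

(** An approximation of a point near 0 or 1 may lie outside [[0, 1]]: [fixpt 0] cuts it off at 0 and
    the minimum at 1. *)
Definition gridpt k w := minn (fixpt 0 k w) (2 ^ k).

(** The last inequality says that the two values are at distance at most [2^-r]. Agreement brings
    every candidate close to the rounding of [gamma]; [r <= k] makes that rounding itself accurate
    to order [2^-r]. *)
Definition agreement k r w :=
  (r <= k) && [forall s : 'I_(code_bound k), [forall s' : 'I_(code_bound k),
    candidate k s ==> (candidate k s' ==>
      (4 ^ r * sqdist k s (gridpt k w) s' (gridpt k w) <= 4 ^ k))]].

(** The numerator follows [zig], where [-d] has code [2 * d - 1] for [d > 0]. The denominator is
    [2 ^ k], and [decq] does not ask for lowest terms. *)
Definition out_coord k s i c :=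
  npair (if A * 2 ^ k <= digit k s i c then (digit k s i c - A * 2 ^ k).*2
         else (A * 2 ^ k - digit k s i c).*2.-1) (2 ^ k).-1.

Fixpoint out_seq m c k s i :=
  if m is m'.+1 then npair (out_coord k s i c) (out_seq m' c.+1 k s i) else 0.

Ltac rec_var :=
  first [exact: (recf_var _ 0 _ _) | exact: (recf_var _ 1 _ _)
        |exact: (recf_var _ 2 _ _) | exact: (recf_var _ 3 _ _)
        |exact: (recf_var _ 4 _ _) | exact: (recf_var _ 5 _ _)].

Lemma rec_fixpt a : rec2 ol (fixpt a).
Proof.
move=> m K W hK hW; apply: recf_if.
- by apply: recb_odd; apply: rec1_nunpair1.
- apply: rec2_sub.
    by apply: rec2_mul; [exact: recf_const|apply: rec2_exp => //; exact: recf_const].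
  apply: rec2_div; last by apply: rec1_succ; apply: rec1_nunpair2.
  apply: rec2_mul; last by apply: rec2_exp => //; exact: recf_const.
  by apply: rec1_half; apply: rec1_succ; apply: rec1_nunpair1.
- apply: rec2_add.
    by apply: rec2_mul; [exact: recf_const|apply: rec2_exp => //; exact: recf_const].
  apply: rec2_div; last by apply: rec1_succ; apply: rec1_nunpair2.
  apply: rec2_mul; last by apply: rec2_exp => //; exact: recf_const.
  by apply: rec1_half; apply: rec1_succ; apply: rec1_nunpair1.
Qed.

Lemma rec_expn a : rec1 ol (expn a).
Proof. by move=> m K hK; apply: rec2_exp => //; exact: recf_const. Qed.

Lemma rec_base : rec1 ol base.
Proof. by move=> m K hK; apply: rec2_mul; [exact: recf_const|exact: rec_expn]. Qed.

Lemma rec_digit c : rec3 ol (fun k s i => digit k s i c).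
Proof.
move=> m K S I hK hS hI; apply: rec2_mod; last exact: rec_base.
apply: rec2_div => //; apply: rec2_exp; first exact: rec_base.
apply: rec2_add; last exact: recf_const.
by apply: rec2_mul => //; exact: recf_const.
Qed.

Lemma rec_absdiff : rec2 ol absdiff.
Proof. by move=> m a b ha hb; apply: rec2_add; apply: rec2_sub. Qed.

Lemma rec_sqdist m K S I S' I' : recf ol m K -> recf ol m S -> recf ol m I ->
  recf ol m S' -> recf ol m I' ->
  recf ol m (fun xs => sqdist (K xs) (S xs) (I xs) (S' xs) (I' xs)).
Proof.
move=> hK hS hI hS' hI'.
apply: (@recf_bigsum ol n m (fun c xs =>
  absdiff (digit (K xs) (S xs) (I xs) c) (digit (K xs) (S' xs) (I' xs) c) ^ 2)) => c.
apply: rec2_exp; last exact: recf_const.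
by apply: rec_absdiff; apply: rec_digit.
Qed.

Lemma rec_lengthpt : rec1 ol lengthpt.
Proof.
move=> m K hK; apply: rec2_add; last exact: recf_const.
by apply: rec_fixpt => //; apply: rec1_oracle.
Qed.

Lemma rec_samplept (c : 'I_n) : rec3 ol (fun k b m => samplept k b m c).
Proof.
move=> m K B M hK hB hM; apply: rec_fixpt => //.
by apply: rec1_decseq => //; exact: rec_P.
Qed.

Lemma rec_candidate : rec2 ol (fun k s => nat_of_bool (candidate k s)).
Proof.
apply: rec2I; apply: recb_and; last apply: recb_and.
- apply: (@recb_forall ol 2 (fun xs => (2 ^ nth 0 xs 0).+1) (fun i xs =>
    [forall j : 'I_(2 ^ nth 0 xs 0).+1, 4 ^ nth 0 xs 0 *
      sqdist (nth 0 xs 0) (nth 0 xs 1) i (nth 0 xs 1) j <=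
      (lengthpt (nth 0 xs 0) * absdiff i j + E * 2 ^ nth 0 xs 0) ^ 2])).
    by apply: rec1_succ; apply: rec_expn; rec_var.
  apply: (@recb_forall ol 3 (fun ys => (2 ^ nth 0 (behead ys) 0).+1) (fun j ys =>
    4 ^ nth 0 (behead ys) 0 *
    sqdist (nth 0 (behead ys) 0) (nth 0 (behead ys) 1) (nth 0 ys 0)
           (nth 0 (behead ys) 1) j <=
    (lengthpt (nth 0 (behead ys) 0) * absdiff (nth 0 ys 0) j
      + E * 2 ^ nth 0 (behead ys) 0) ^ 2)).
    by apply: rec1_succ; apply: rec_expn; rec_var.
  apply: recb_leq.
    apply: rec2_mul; first by apply: rec_expn; rec_var.
    by apply: rec_sqdist; rec_var.
  apply: rec2_exp; last exact: recf_const.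
  apply: rec2_add; last first.
    by apply: rec2_mul; [exact: recf_const|apply: rec_expn; rec_var].
  by apply: rec2_mul; [apply: rec_lengthpt|apply: rec_absdiff]; rec_var.
- apply: (@recb_forall ol 2 (fun xs => nth 0 xs 0) (fun m xs =>
    [forall b : 'I_(2 ^ m), [exists i : 'I_(2 ^ nth 0 xs 0).+1,
      \sum_(c < n) absdiff (digit (nth 0 xs 0) (nth 0 xs 1) i c)
        (samplept (nth 0 xs 0) b m c) ^ 2 <= E ^ 2]])); first rec_var.
  apply: (@recb_forall ol 3 (fun ys => 2 ^ nth 0 ys 0) (fun b ys =>
    [exists i : 'I_(2 ^ nth 0 (behead ys) 0).+1,
      \sum_(c < n) absdiff (digit (nth 0 (behead ys) 0) (nth 0 (behead ys) 1) i c)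
        (samplept (nth 0 (behead ys) 0) b (nth 0 ys 0) c) ^ 2 <= E ^ 2])).
    by apply: rec_expn; rec_var.
  apply: (@recb_exists ol 4 (fun zs => (2 ^ nth 0 (behead (behead zs)) 0).+1)
    (fun i zs => \sum_(c < n)
      absdiff (digit (nth 0 (behead (behead zs)) 0) (nth 0 (behead (behead zs)) 1) i c)
        (samplept (nth 0 (behead (behead zs)) 0) (nth 0 zs 0)
                  (nth 0 (behead zs) 0) c) ^ 2 <= E ^ 2)).
    by apply: rec1_succ; apply: rec_expn; rec_var.
  apply: recb_leq; last exact: recf_const.
  apply: recf_bigsum => c; apply: rec2_exp; last exact: recf_const.
  apply: rec_absdiff; first by apply: rec_digit; rec_var.
  by apply: rec_samplept; rec_var.
- apply: recb_leq; apply: rec_digit; try rec_var.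
  + by apply: rec2_mul; [exact: recf_const|apply: rec_expn; rec_var].
  + by apply: rec2_mul; [exact: recf_const|apply: rec_expn; rec_var].
Qed.

Lemma rec_code_bound : rec1 ol code_bound.
Proof.
move=> m K hK; apply: rec2_exp; first exact: rec_base.
apply: rec2_mul; last exact: recf_const.
by apply: rec1_succ; apply: rec_expn.
Qed.

Lemma rec_gridpt : rec2 ol gridpt.
Proof.
by move=> m K W hK hW; apply: rec2_min; [exact: rec_fixpt|exact: rec_expn].
Qed.

Lemma rec_agreement : rec3 ol (fun k r w => nat_of_bool (agreement k r w)).
Proof.
apply: rec3I; apply: recb_and; first by apply: recb_leq; rec_var.
apply: (@recb_forall ol 3 (fun xs => code_bound (nth 0 xs 0)) (fun s xs =>
  [forall s' : 'I_(code_bound (nth 0 xs 0)),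
    candidate (nth 0 xs 0) s ==> (candidate (nth 0 xs 0) s' ==>
    (4 ^ nth 0 xs 1 * sqdist (nth 0 xs 0) s (gridpt (nth 0 xs 0) (nth 0 xs 2)) s'
       (gridpt (nth 0 xs 0) (nth 0 xs 2)) <= 4 ^ nth 0 xs 0))])).
  by apply: rec_code_bound; rec_var.
apply: (@recb_forall ol 4 (fun ys => code_bound (nth 0 (behead ys) 0)) (fun s' ys =>
    candidate (nth 0 (behead ys) 0) (nth 0 ys 0) ==>
    (candidate (nth 0 (behead ys) 0) s' ==>
    (4 ^ nth 0 (behead ys) 1 *
     sqdist (nth 0 (behead ys) 0) (nth 0 ys 0)
       (gridpt (nth 0 (behead ys) 0) (nth 0 (behead ys) 2)) s'
       (gridpt (nth 0 (behead ys) 0) (nth 0 (behead ys) 2))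
     <= 4 ^ nth 0 (behead ys) 0)))).
  by apply: rec_code_bound; rec_var.
apply: recb_imp; first by apply: rec_candidate; rec_var.
apply: recb_imp; first by apply: rec_candidate; rec_var.
apply: recb_leq; last by apply: rec_expn; rec_var.
apply: rec2_mul; first by apply: rec_expn; rec_var.
by apply: rec_sqdist; try apply: rec_gridpt; rec_var.
Qed.

Lemma rec_out_coord c : rec3 ol (fun k s i => out_coord k s i c).
Proof.
move=> m K S I hK hS hI.
have hA : recf ol m (fun xs => A * 2 ^ K xs).
  by apply: rec2_mul; [exact: recf_const|exact: rec_expn].
have hD : recf ol m (fun xs => digit (K xs) (S xs) (I xs) c) by apply: rec_digit.
apply: rec2_npair; last by apply: rec1_pred; exact: rec_expn.
apply: recf_if; first exact: recb_leq.
  by apply: rec1_double; apply: rec2_sub.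
by apply: rec1_pred; apply: rec1_double; apply: rec2_sub.
Qed.

Lemma rec_out_seq j c : rec3 ol (fun k s i => out_seq j c k s i).
Proof.
elim: j c => [|j IH] c m K S I hK hS hI; first exact: recf_const.
by apply: rec2_npair; [apply: rec_out_coord|apply: IH].
Qed.

(* The least level at which all candidates agree near the queried point is
   found by unbounded search, and then any candidate is good enough. *)
Lemma search_code D : exists M : code, forall ot r k s,
  let w := ot (r + D) in
  agreement k (r + D) w -> (forall k', k' < k -> ~~ agreement k' (r + D) w) ->
  candidate k s -> (forall s', s' < s -> ~~ candidate k s') ->
  eval [:: ot; ol] M [:: r] (out_seq n 0 k s (gridpt k w)).
Proof.
have [ct hct] : recf ol 3 (fun xs =>
    nat_of_bool (~~ agreement (nth 0 xs 0) (nth 0 xs 1 + D) (nth 0 xs 2))).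
  apply: recb_not; apply: rec_agreement; try rec_var.
  by apply: rec2_add; [rec_var|exact: recf_const].
have [cc hcc] : recf ol 2 (fun xs => nat_of_bool (~~ candidate (nth 0 xs 1) (nth 0 xs 0))).
  by apply: recb_not; apply: rec_candidate; rec_var.
have [co hco] : recf ol 3 (fun xs => out_seq n 0 (nth 0 xs 0) (nth 0 xs 1)
    (gridpt (nth 0 xs 0) (nth 0 xs 2))).
  by apply: rec_out_seq; try apply: rec_gridpt; rec_var.
have [cd hcd] : recf ol 1 (fun xs => nth 0 xs 0 + D).
  by apply: rec2_add; [rec_var|exact: recf_const].
pose W := CComp (COrc 0) [:: cd].
pose K := CComp (CMu ct) [:: CProj 0; W].
pose S := CComp (CMu cc) [:: K].
exists (CComp co [:: K; S; W]) => ot r k s w hk kmin hs smin.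
have one c xs y : eval [:: ot; ol] c xs y -> evals [:: ot; ol] [:: c] xs [:: y].
  by move=> h; constructor => //; constructor.
have eW : eval [:: ot; ol] W [:: r] w.
  by apply: (@ev_comp _ _ _ _ [:: r + D]); [apply: one; exact: hcd|exact: ev_orc].
have eK : eval [:: ot; ol] K [:: r] k.
  apply: (@ev_comp _ _ _ _ [:: r; w]).
    by constructor; [exact: ev_proj|exact: one].
  apply: ev_mu => [|k' lt].
    by have := hct ot [:: k; r; w] erefl; rewrite /= hk.
  exists 1 => //; have := hct ot [:: k'; r; w] erefl.
  by rewrite /= kmin.
have eS : eval [:: ot; ol] S [:: r] s.
  apply: (@ev_comp _ _ _ _ [:: k]); first exact: one.
  apply: ev_mu => [|s' lt].
    by have := hcc ot [:: s; k] erefl; rewrite /= hs.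
  by exists 1 => //; have := hcc ot [:: s'; k] erefl; rewrite /= smin.
apply: (@ev_comp _ _ _ _ [:: k; s; w]); last exact: (hco ot [:: k; s; w]).
by do 2 constructor => //; exact: one.
Qed.

End Program.

(** * Convergence of grid functions *)

Local Open Scope classical_set_scope.
Local Open Scope ring_scope.

Section UltraLimits.
Context {R : realType}.

(** Compactness gives a cluster point, and an ultrafilter converges to each of its cluster
    points. *)
Lemma ultra_bounded_cvg (U : set_system nat) (u : nat -> R) (B : R) :
  UltraFilter U -> U [set k | `|u k| <= B] -> exists l : R, u k @[k --> U] --> l.
Proof.
move=> UU hB.
have [|l [_ hl]] := @segment_compact R (- B) B (u @ U) _.
  by apply: filterS hB => k hk; rewrite /= in_itv /= -ler_norml; exact: hk.
exists l => N hN; have [//|hc] := in_ultra_setVsetC (u @^-1` N) UU.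
by have [x [nx Nx]] := hl (~` N) N hc hN.
Qed.

Lemma exp2_inv_small (C e : R) : 0 < e ->
  exists N, forall k, (N <= k)%N -> C * (2 ^+ k)^-1 <= e.
Proof.
move=> e0; exists (Num.trunc (`|C| / e)).+1 => k le.
apply: (@le_trans _ _ (`|C| * (2 ^+ k)^-1)).
  by apply: ler_wpM2r; rewrite ?invr_ge0 ?exprn_ge0 ?ler_norm.
rewrite ler_pdivrMr ?exprn_gt0 // mulrC -ler_pdivrMr //.
apply: le_trans (ltW (truncnS_gt _)) _.
by rewrite -natrX ler_nat (leq_trans le) // ltnW // ltn_expl.
Qed.

Lemma grid_floor (t : R) k : 0 <= t <= 1 ->
  (Num.trunc (t * 2 ^+ k) <= 2 ^ k)%N /\
  `|(Num.trunc (t * 2 ^+ k))%:R / 2 ^+ k - t| <= (2 ^+ k)^-1.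
Proof.
move=> /andP [t0 t1]; have P0 : 0 < 2 ^+ k :> R by rewrite exprn_gt0.
have tP0 : 0 <= t * 2 ^+ k by rewrite mulr_ge0 // ltW.
have /andP [h1 h2] := truncn_itv tP0; split.
  rewrite -(ler_nat R) (le_trans h1) // natrX -[leRHS]mul1r.
  by rewrite ler_pM2r.
have -> : (Num.trunc (t * 2 ^+ k))%:R / 2 ^+ k - t =
    ((Num.trunc (t * 2 ^+ k))%:R - t * 2 ^+ k) / 2 ^+ k.
  by field; rewrite gt_eqF.
rewrite normrM (@ger0_norm _ (_ ^-1)) ?invr_ge0 ?(ltW P0) //.
rewrite -[leRHS]mul1r ler_pM2r ?invr_gt0 // ler_norml -natr1 in h2 *; lra.
Qed.

End UltraLimits.

(** * Limits of grid functions along an ultrafilter *)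

Section GridConvergence.
Context {R : realType} {n : nat}.
Local Notation V := 'rV[R]_n.
Variables (g : R -> V) (L : R).
Hypothesis cg : continuous g.
Hypothesis inj_g : forall s t, 0 <= s <= 1 -> 0 <= t <= 1 -> g s = g t -> s = t.
Hypothesis len_g : forall t, 0 <= t <= 1 -> H1 (g @` `[0, t]) = (t * L)%:E.
Hypothesis g_clamp : forall t, g (clamp01 t) = g t.
Variables (c0 : 'I_n) (beta : bool).
Hypothesis dir_g : g beta%:R ord0 c0 < g (~~ beta)%:R ord0 c0.

Variable Q : set V.
Hypothesis Q_dense : forall x e, (g @` `[0, 1]) x -> 0 < e ->
  exists2 y, Q y & edist y x <= e.

Variables (G : nat -> nat -> V) (B C : R) (K : nat).
Hypothesis G_bounded : forall k i c, `|G k i ord0 c| <= B.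
Hypothesis G_lip : forall k i j, (K <= k)%N -> (i <= 2 ^ k)%N -> (j <= 2 ^ k)%N ->
  edist (G k i) (G k j) <= L * `|i%:R / 2 ^+ k - j%:R / 2 ^+ k| + C * (2 ^+ k)^-1.
Hypothesis G_cover : forall y, Q y -> exists K', forall k, (K' <= k)%N ->
  exists2 i, (i <= 2 ^ k)%N & edist (G k i) y <= C * (2 ^+ k)^-1.
Hypothesis G_dir : forall k, (K <= k)%N ->
  G k (beta * 2 ^ k)%N ord0 c0 <= G k (~~ beta * 2 ^ k)%N ord0 c0.

Variable U : set_system nat.
Hypothesis UU : UltraFilter U.
Hypothesis U_oo : forall N, U [set k | (N <= k)%N].

Let h k (t : R) := G k (Num.trunc (clamp01 t * 2 ^+ k)).

(** One ultrafilter provides limits at all [t] at once, so no diagonal subsequence is extracted. *)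
Lemma grid_limit_exists : exists f : R -> V, forall t e, 0 < e ->
  U [set k | edist (h k t) (f t) <= e].
Proof.
have lim t c : exists l : R, h k t ord0 c @[k --> U] --> l.
  by apply: (@ultra_bounded_cvg _ _ _ B) => //; apply: filterS (U_oo 0) => k _;
    exact: G_bounded.
have /choice [l hl] : forall x : R * 'I_n, exists l : R, h k x.1 ord0 x.2 @[k --> U] --> l.
  by move=> [t c]; exact: lim.
exists (fun t => \row_c l (t, c)) => t e e0.
have : edist (h k t) (\row_c l (t, c)) @[k --> U] --> edist (\row_c l (t, c)) (\row_c l (t, c)).
  apply: cvg_edist => c; last exact: cvg_cst.
  by rewrite mxE; exact: (hl (t, c)).
rewrite edistxx => /cvgr_le; exact.
Qed.

Lemma grid_lip k s t : (K <= k)%N ->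
  edist (h k s) (h k t) <= L * `|s - t| + (2 * L + C) * (2 ^+ k)^-1.
Proof.
move=> Kk; have L0 := ltW (arclength_gt0 cg inj_g len_g).
have [s1 s2] := grid_floor k (clamp01_itv s).
have [t1 t2] := grid_floor k (clamp01_itv t).
apply: le_trans (G_lip Kk s1 t1) _.
have := clamp01_lip s t; move: s2 t2; rewrite /h.
set a := _ / _; set b := (_%:R / _); set e := (_ ^-1) => s2 t2 st.
have : L * `|a - b| <= L * (`|s - t| + 2 * e).
  apply: ler_wpM2l => //; apply: (@le_trans _ _ (`|clamp01 s - clamp01 t| + 2 * e)).
    move: s2 t2; have := ler_norm (clamp01 s - clamp01 t).
    have := lerNnormlW (lexx `|clamp01 s - clamp01 t|).
    by rewrite !ler_norml; lra.
  by rewrite lerD2r.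
lra.
Qed.

Lemma U_small (c e : R) : 0 < e -> U [set k | c * (2 ^+ k)^-1 <= e].
Proof.
by move=> /(exp2_inv_small c) [N hN]; apply: filterS (U_oo N) => k; exact: hN.
Qed.

Lemma le_eps (x y : R) : (forall e, 0 < e -> x <= y + e) -> x <= y.
Proof. by move=> hxy; apply/ler_addgt0Pr. Qed.

Lemma grid_converges tau e : 0 <= tau <= 1 -> 0 < e ->
  U [set k | edist (G k (Num.trunc (tau * 2 ^+ k))) (g tau) <= e].
Proof.
move=> tau01; have L0 := arclength_gt0 cg inj_g len_g.
have [f hf] := grid_limit_exists.
have lip_f : lipschitz_with L f.
  move=> s t; apply: le_eps => d d0; have d3 : 0 < d / 3 by lra.
  have [k [[[k1 k2] k3] k4]] := filter_ex (filterI (filterI (filterI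
    (hf s _ d3) (hf t _ d3)) (U_small (2 * L + C) d3)) (U_oo K)).
  have := edist_triangle (h k s) (f s) (f t).
  have := edist_triangle (h k t) (h k s) (f t).
  have := grid_lip s t k4; move: k1 k2 k3 => /=.
  by rewrite (edistC (h k s) (f s)); lra.
(* The grid point that comes near [y] depends on the level. Its position converges along the same
   ultrafilter to some [u], and the discrete Lipschitz bound carries the value over to [u]. *)
have f_Q y : Q y -> exists2 u, 0 <= u <= 1 & f u = y.
  move=> Qy; have [K' hK'] := G_cover Qy.
  have /choice [i hi] : forall k, exists i, (K' <= k)%N ->
      (i <= 2 ^ k)%N /\ edist (G k i) y <= C * (2 ^+ k)^-1.
    move=> k; case: (leqP K' k) => [/hK' [i i1 i2]|_]; last by exists 0%N.
    by exists i.
  pose p k : R := (i k)%:R / 2 ^+ k.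
  have p01 k : (K' <= k)%N -> 0 <= p k <= 1.
    move=> /hi [le _]; rewrite /p divr_ge0 ?exprn_ge0 //=.
    by rewrite ler_pdivrMr ?exprn_gt0 // mul1r -natrX ler_nat.
  have [u hu] : exists u : R, p k @[k --> U] --> u.
    apply: (@ultra_bounded_cvg _ _ _ 1) => //; apply: filterS (U_oo K') => k /p01 /=.
    by rewrite ler_norml; lra.
  have close d : 0 < d -> U [set k | `|u - p k| <= d].
    by move=> d0; have /cvgrPdist_le := hu; apply.
  have u01 : 0 <= u <= 1.
    apply/andP; split; apply: le_eps => d d0.
      have [k [k1 /p01 k2]] := filter_ex (filterI (close d d0) (U_oo K')).
      by move: k1; rewrite /= ler_norml; lra.
    have [k [k1 /p01 k2]] := filter_ex (filterI (close d d0) (U_oo K')).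
    by move: k1; rewrite /= ler_norml; lra.
  exists u => //; apply: edist_eq0; apply/eqP; rewrite eq_le edist_ge0 andbT.
  apply: le_eps => d d0; rewrite add0r.
  have d3 : 0 < d / 3 by lra.
  have dL : 0 < d / 3 / L by rewrite divr_gt0.
  have [k [[[[k1 k2] k3] k4] k5]] := filter_ex (filterI (filterI (filterI (filterI
    (hf u _ d3) (close _ dL)) (U_small (L + C + C) d3)) (U_oo K)) (U_oo K')).
  have [ik iy] := hi k k5.
  have [u1 u2] := grid_floor k u01.
  have hik : edist (h k u) (G k (i k)) <= L * (d / 3 / L + (2 ^+ k)^-1) + C * (2 ^+ k)^-1.
    rewrite /h clamp01_id //; apply: le_trans (G_lip k4 u1 ik) _.
    rewrite lerD2r; apply: ler_wpM2l; first exact: ltW.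
    move: k2 u2; rewrite /p /= !ler_norml.
    set a := _ / _; set b := _ / _ ^+ _; lra.
  have LdL : L * (d / 3 / L) = d / 3 by field; rewrite gt_eqF.
  have := edist_triangle (h k u) (f u) y.
  have := edist_triangle (G k (i k)) (h k u) y.
  move: k1 k3 hik; rewrite /= (edistC (h k u) (f u)) (mulrDr L) LdL; lra.
have cf := lipschitz_with_continuous lip_f.
(* The image of [f] is compact and contains a dense subset of the curve. *)
have f_onto : g @` `[0, 1] `<=` f @` `[0, 1].
  move=> x gx; apply: contrapT => nx.
  have [m m0 hm] := point_arc_separated ler01 cf nx.
  have m2 : 0 < m / 2 by lra.
  have [y Qy yx] := Q_dense gx m2.
  have [u u01 fu] := f_Q y Qy.
  by have := hm u u01; rewrite fu edistC; lra.
have fg : forall t, 0 <= t <= 1 -> f t = g t.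
  have [//|rev] := lipschitz_param_unique cg inj_g len_g g_clamp lip_f f_onto.
  have b01 (b : bool) : 0 <= (b%:R : R) <= 1 by case: b; rewrite /=; lra.
  have hb (b : bool) k : h k b%:R = G k (b * 2 ^ k)%N.
    rewrite /h clamp01_id //; congr G.
    by rewrite -natrX -natrM natrK.
  suff : f beta%:R ord0 c0 <= f (~~ beta)%:R ord0 c0.
    rewrite !rev // leNgt; suff e1 (b : bool) : 1 - b%:R = (~~ b)%:R :> R.
      by rewrite !e1 negbK dir_g.
    by case: b; rewrite /= ?subrr ?subr0.
  apply: le_eps => d d0; have d2 : 0 < d / 2 by lra.
  have [k [[k1 k2] k3]] := filter_ex (filterI (filterI
    (hf beta%:R _ d2) (hf (~~ beta)%:R _ d2)) (U_oo K)).
  have := coord_le_edist (h k beta%:R) (f beta%:R) c0.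
  have := coord_le_edist (h k (~~ beta)%:R) (f (~~ beta)%:R) c0.
  have := G_dir k3; rewrite -!hb !ler_norml; move: k1 k2 => /=; lra.
move=> e0; apply: filterS (hf tau e e0) => k /=.
by rewrite /h clamp01_id // fg.
Qed.

End GridConvergence.

(** * Correctness of the search *)

Lemma digits_exist b N (d : nat -> nat) : (forall m, (m < N)%N -> (d m < b)%N) ->
  exists2 s, (s < b ^ N)%N &
    forall m, (m < N)%N -> ((s %/ b ^ m) %% b)%N = d m.
Proof.
elim: N => [|N IH] hd; first by exists 0%N.
have [|s sN hs] := IH; first by move=> m mN; apply: hd; rewrite ltnW.
have dN := hd N (ltnSn N).
have b0 : (0 < b)%N by apply: leq_ltn_trans dN.
exists (d N * b ^ N + s)%N.
  rewrite expnS (@leq_trans ((d N).+1 * b ^ N)%N) ?leq_mul //.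
  by rewrite mulSn addnC ltn_add2r.
move=> m; rewrite ltnS leq_eqVlt => /orP [/eqP ->|mN].
  by rewrite divnMDl ?expn_gt0 ?b0 // divn_small // addn0 modn_small.
have -> : (d N * b ^ N = d N * b ^ (N - m).-1 * b * b ^ m)%N.
  by rewrite -!mulnA; congr muln; rewrite -expnS -expnD; congr expn; lia.
by rewrite divnMDl ?expn_gt0 ?b0 // modnMDl hs.
Qed.

(** * Grid functions and their codes *)

Section GridValues.
Context {R : realType} {n : nat}.
Variable A : nat.
Local Notation V := 'rV[R]_n.

Definition natpt (k : nat) (a : nat -> nat) : V :=
  \row_(c < n) ((a c)%:R / 2 ^+ k - A%:R).

Definition gridval (k s i : nat) : V := natpt k (digit n A k s i).

Lemma natr_absdiff a b : (absdiff a b)%:R = `|a%:R - b%:R| :> R.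
Proof.
have [ab|ba] := leqP a b; rewrite /absdiff.
  by rewrite (eqP ab) add0n natrB // ler0_norm ?opprB // subr_le0 ler_nat.
rewrite (eqP (ltnW ba)) addn0 natrB ?(ltnW ba) // ger0_norm //.
by rewrite subr_ge0 ler_nat ltnW.
Qed.

Lemma edist_natpt k (a b : nat -> nat) (e : R) : 0 <= e ->
  (edist (natpt k a) (natpt k b) <= e) =
  ((\sum_(c < n) absdiff (a c) (b c) ^ 2)%:R <= (e * 2 ^+ k) ^+ 2).
Proof.
move=> e0; have P0 : 0 < 2 ^+ k :> R by rewrite exprn_gt0.
have e1 : \sum_(c < n) (natpt k a ord0 c - natpt k b ord0 c) ^+ 2 =
    (\sum_(c < n) absdiff (a c) (b c) ^ 2)%:R / (2 ^+ k) ^+ 2 :> R.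
  rewrite natr_sum mulr_suml; apply: eq_bigr => c _.
  rewrite !mxE natrX natr_absdiff real_normK ?num_real //.
  by field; rewrite gt_eqF.
by rewrite edist_le // e1 exprMn ler_pdivrMr ?exprn_gt0.
Qed.

Lemma edist_gridval k s i s' i' (e : R) : 0 <= e ->
  (edist (gridval k s i) (gridval k s' i') <= e) =
  ((sqdist n A k s i s' i')%:R <= (e * 2 ^+ k) ^+ 2).
Proof. exact: edist_natpt. Qed.

Lemma gridval_bounded k s i (c : 'I_n) : (0 < A)%N -> `|gridval k s i ord0 c| <= A%:R.
Proof.
move=> A0; have P0 : 0 < 2 ^+ k :> R by rewrite exprn_gt0.
have d0 : 0 <= (digit n A k s i c)%:R / 2 ^+ k :> R by rewrite divr_ge0 // ltW.
have : (digit n A k s i c)%:R / 2 ^+ k <= (2 * A)%:R :> R; last first.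
  by rewrite /gridval /natpt mxE ler_norml natrM; lra.
rewrite ler_pdivrMr // -natrX -natrM ler_nat /digit.
by rewrite ltnW // ltn_pmod // /base !muln_gt0 A0 expn_gt0.
Qed.

Lemma gridpt_close k w :
  (gridpt k w <= 2 ^ k)%N /\
  `|(gridpt k w)%:R / 2 ^+ k - clamp01 (ratr (decq w))| <= (2 ^+ k)^-1 :> R.
Proof.
split; first exact: geq_minr.
have P0 : 0 < 2 ^+ k :> R by rewrite exprn_gt0.
have := fixptP (R := R) 0 k w; rewrite addr0.
have i0 : 0 < (2 ^+ k)^-1 :> R by rewrite invr_gt0.
rewrite clamp01E /gridpt; set x := ratr _; set f := fixpt _ _ _.
have [fk|fk] := leqP f (2 ^ k).
  have : f%:R / 2 ^+ k <= 1 :> R.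
    by rewrite ler_pdivrMr // mul1r -natrX ler_nat.
  by rewrite !ler_norml; case: (leP x 0) => x0; case: (leP x 1) => x1; lra.
have : 1 <= f%:R / 2 ^+ k :> R.
  by rewrite ler_pdivlMr // mul1r -natrX ler_nat ltnW.
rewrite natrX divff ?gt_eqF // !ler_norml.
by case: (leP x 0) => x0; case: (leP x 1) => x1; lra.
Qed.

Lemma rounding_exists (c0 : 'I_n) k (v : nat -> V) :
  (forall i (c : 'I_n), 0 <= v i ord0 c + A%:R < (2 * A)%:R) ->
  exists2 s, (s < code_bound n A k)%N & forall i (c : 'I_n), (i <= 2 ^ k)%N ->
    digit n A k s i c = Num.trunc ((v i ord0 c + A%:R) * 2 ^+ k).
Proof.
move=> hv; have P0 : 0 < 2 ^+ k :> R by rewrite exprn_gt0.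
have n0 : (0 < n)%N by apply: leq_ltn_trans (ltn_ord c0).
(* Digit [i * n + c] holds coordinate [c] at grid point [i]; [insubd c0] turns the remainder into an
   ordinal. *)
pose d m := Num.trunc ((v (m %/ n)%N ord0 (insubd c0 (m %% n)%N) + A%:R) * 2 ^+ k).
have [m _|s sN hs] := @digits_exist (base A k) ((2 ^ k).+1 * n) d.
  have /andP [h1 h2] := hv (m %/ n)%N (insubd c0 (m %% n)%N).
  rewrite -(ltr_nat R) /base; apply: le_lt_trans (_ : (v (m %/ n)%N ord0
    (insubd c0 (m %% n)%N) + A%:R) * 2 ^+ k < _).
    by rewrite truncn_le mulr_ge0 // ltW.
  by rewrite natrM natrX ltr_pM2r.
exists s => // i c ik; rewrite /digit hs.
  rewrite /d divnMDl // divn_small // addn0 modnMDl modn_small //.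
  by rewrite valKd.
by rewrite mulSn addnC; have := ltn_ord c; nia.
Qed.

End GridValues.

(** * Existence, convergence and agreement of candidates *)

Section Search.
Context {R : realType} {n : nat}.
Local Notation V := 'rV[R]_n.
Variables (g : R -> V) (L : R).
Hypothesis cg : continuous g.
Hypothesis inj_g : forall s t, 0 <= s <= 1 -> 0 <= t <= 1 -> g s = g t -> s = t.
Hypothesis len_g : forall t, 0 <= t <= 1 -> H1 (g @` `[0, t]) = (t * L)%:E.
Hypothesis g_clamp : forall t, g (clamp01 t) = g t.
Variables (c0 : 'I_n) (beta : bool).
Hypothesis dir_g : g beta%:R ord0 c0 < g (~~ beta)%:R ord0 c0.
Variable Ol : nat -> rat.
Hypothesis Ol_L : is_oracle L Ol.
Variables (A E : nat) (P : nat -> nat -> nat -> nat) (y : nat -> nat -> V).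
Hypothesis g_bounded : forall t c, `|g t ord0 c| + 1 <= A%:R.
Hypothesis E_large : 3 * n%:R + L <= E%:R.
Hypothesis P_y : forall b m r,
  edist (map_mx ratr (decpt n (P b m r))) (y b m) <= (2 ^+ r)^-1.
Hypothesis y_g : forall b m, (g @` `[0, 1]) (y b m).
Hypothesis y_dense : forall x e, (g @` `[0, 1]) x -> 0 < e ->
  exists b m, (b < 2 ^ m)%N /\ edist (y b m) x <= e.

Let ol := encq \o Ol.
Let cand k s := candidate A E beta c0 ol P k s.
Let gv k s i : V := gridval A k s i.
Let eps k : R := (2 ^+ k)^-1.

Let L0 : 0 < L := arclength_gt0 cg inj_g len_g.
Let lip_g : lipschitz_with L g := arclength_lipschitz cg inj_g len_g g_clamp.

Let pow0 k : 0 < 2 ^+ k :> R. Proof. by rewrite exprn_gt0. Qed.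
Let eps0 k : 0 < eps k. Proof. by rewrite invr_gt0. Qed.

Lemma lengthpt_bounds k :
  L <= (lengthpt ol k)%:R / 2 ^+ k <= L + 4 * eps k.
Proof.
have := fixptP (R := R) 0 k (ol k); rewrite addr0 /lengthpt /ol /= encqK.
have := Ol_L k; rewrite -/(eps k) natrD mulrDl -/(eps k).
set x := ratr _; set f := _ / _.
by have := eps0 k; have := L0; rewrite !ler_norml; case: (leP 0 x) => x0; lra.
Qed.

Lemma lip_testP k s : reflect
  (forall i j, (i <= 2 ^ k)%N -> (j <= 2 ^ k)%N -> edist (gv k s i) (gv k s j) <=
     (lengthpt ol k)%:R / 2 ^+ k * `|i%:R / 2 ^+ k - j%:R / 2 ^+ k| + E%:R * eps k)
  (lip_test n A E ol k s).
Proof.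
have step i j : (edist (gv k s i) (gv k s j) <=
     (lengthpt ol k)%:R / 2 ^+ k * `|i%:R / 2 ^+ k - j%:R / 2 ^+ k| + E%:R * eps k) =
   (4 ^ k * sqdist n A k s i s j <= (lengthpt ol k * absdiff i j + E * 2 ^ k) ^ 2)%N.
  have a0 : 0 <= `|i%:R - j%:R| :> R by [].
  have -> : `|i%:R / 2 ^+ k - j%:R / 2 ^+ k| = `|i%:R - j%:R| / 2 ^+ k :> R.
    by rewrite -mulrBl normrM (@ger0_norm _ (_ ^-1)) // ltW // eps0.
  rewrite edist_gridval; last first.
    by rewrite addr_ge0 ?mulr_ge0 ?invr_ge0 ?(ltW (pow0 _)).
  rewrite -(ler_nat R) natrM !natrX natrD !natrM natr_absdiff natrX.
  have -> : 4 ^+ k = 2 ^+ k ^+ 2 :> R by rewrite -exprM mulnC exprM; congr (_ ^+ k); rewrite -natrX.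
  set a := `|_|; set l := (lengthpt _ _)%:R.
  have -> : l * a + E%:R * 2 ^+ k =
      2 ^+ k * ((l / 2 ^+ k * (a / 2 ^+ k) + E%:R * eps k) * 2 ^+ k).
    by rewrite /eps; field; rewrite gt_eqF.
  by rewrite [(2 ^+ k * (_ * 2 ^+ k)) ^+ 2]exprMn ler_pM2l ?exprn_gt0.
apply: (iffP forallP) => [h i j ik jk|h i].
  have /forallP/(_ (Ordinal (jk : j < (2 ^ k).+1)%N)) :=
    h (Ordinal (ik : i < (2 ^ k).+1)%N).
  by rewrite -step.
by apply/forallP => j; rewrite -step; apply: h; rewrite -ltnS ltn_ord.
Qed.

Lemma g_arc_bounded x c : (g @` `[0, 1]) x -> `|x ord0 c| + 1 <= A%:R.
Proof. by move=> [t _ <-]. Qed.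

Lemma samplept_close k b m :
  edist (natpt A k (samplept n A P k b m)) (y b m) <= n%:R * (2 * eps k).
Proof.
apply: edist_le_coord => [|c]; first by rewrite mulr_ge0 // ltW.
have := g_arc_bounded c (y_g b m).
have := coord_le_edist (map_mx ratr (decpt n (P b m k))) (y b m) c.
have := P_y b m k; rewrite -/(eps k).
have := fixptP (R := R) A k (nth 0%N (decseq n (P b m k)) c).
rewrite /samplept !mxE -/(eps k); set f := _ / _; set x := ratr _.
(* The slack 1 in [g_bounded] keeps the approximate coordinate above [-A], so [fixpt] does not cut
   it off. *)
have e1 : eps k <= 1 by rewrite /eps invf_le1 // exprn_ege1 // ler1n.
by have := lerNnormlW (lexx `|y b m ord0 c|); rewrite !ler_norml;
  case: (leP 0 (x + A%:R)) => x0; lra.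
Qed.

(** Rounding [g] down costs [n * eps k] at each grid point, hence [2 * n] units in the Lipschitz
    test. The cover test costs [n] units for the rounding, [2 * n] for the sample and [L] for moving
    to a grid point; this is the origin of [3 * n + L] in [E_large]. *)
Lemma candidate_exists k : exists2 s, (s < code_bound n A k)%N & cand k s /\
  forall i, (i <= 2 ^ k)%N -> edist (gv k s i) (g (i%:R / 2 ^+ k)) <= n%:R * eps k.
Proof.
have [|s sb hs] := @rounding_exists R n A c0 k (fun i => g (i%:R / 2 ^+ k)).
  move=> i c; have := g_bounded (i%:R / 2 ^+ k) c; set u := g _ ord0 c.
  by have := ler_norm u; have := lerNnormlW (lexx `|u|); rewrite natrM; lra.
have close i : (i <= 2 ^ k)%N -> edist (gv k s i) (g (i%:R / 2 ^+ k)) <= n%:R * eps k.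
  move=> ik; apply: edist_le_coord => [|c]; first exact: ltW.
  rewrite !mxE hs //; set u := g _ ord0 c.
  have u0 : 0 <= (u + A%:R) * 2 ^+ k.
    rewrite mulr_ge0 ?(ltW (pow0 _)) //; have := g_bounded (i%:R / 2 ^+ k) c.
    by have := lerNnormlW (lexx `|u|); rewrite -/u; lra.
  have /andP [h1 h2] := truncn_itv u0.
  have -> : (Num.trunc ((u + A%:R) * 2 ^+ k))%:R / 2 ^+ k - A%:R - u =
      ((Num.trunc ((u + A%:R) * 2 ^+ k))%:R - (u + A%:R) * 2 ^+ k) * eps k.
    by rewrite /eps; field; rewrite gt_eqF.
  rewrite normrM (gtr0_norm (eps0 k)) -[leRHS]mul1r ler_pM2r //.
  by rewrite -natr1 in h2; rewrite ler_norml; lra.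
exists s => //; split => //; apply/and3P; split.
- apply/lip_testP => i j ik jk.
  have /andP [l1 _] := lengthpt_bounds k.
  have := lip_g (i%:R / 2 ^+ k) (j%:R / 2 ^+ k).
  set d := `|_ - _|; have d0 : 0 <= d by exact: normr_ge0.
  have : L * d <= (lengthpt ol k)%:R / 2 ^+ k * d by apply: ler_wpM2r.
  have := edist_triangle (g (i%:R / 2 ^+ k)) (gv k s i) (gv k s j).
  have := edist_triangle (g (j%:R / 2 ^+ k)) (g (i%:R / 2 ^+ k)) (gv k s j).
  have := close i ik; have := close j jk; rewrite (edistC (gv k s j)).
  have : (3 * n%:R + L) * eps k <= E%:R * eps k by apply: ler_wpM2r => //; exact: ltW.
  have : 0 <= L * eps k by rewrite mulr_ge0 ?ltW.
  have : 0 <= n%:R * eps k by rewrite mulr_ge0 // ltW.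
  rewrite mulrDl -mulrA; lra.
- apply/forallP => m; apply/forallP => b.
  have [u + gu] := y_g b m; rewrite /= in_itv /= => u01.
  have [i1 i2] := grid_floor k u01.
  apply/existsP; exists (Ordinal (i1 : _ < (2 ^ k).+1)%N) => /=.
  set i := Num.trunc _ in i1 i2 *.
  have := samplept_close k b m; have := close i i1.
  have := lip_g (i%:R / 2 ^+ k) u; rewrite gu.
  have : L * `|i%:R / 2 ^+ k - u| <= L * eps k by apply: ler_wpM2l => //; exact: ltW.
  set z := natpt A k _ => h1 h2 h3 h4.
  have : edist (gv k s i) z <= E%:R * eps k.
    have := edist_triangle (g (i%:R / 2 ^+ k)) (gv k s i) z.
    have := edist_triangle (y b m) (g (i%:R / 2 ^+ k)) z.
    rewrite (edistC (y b m)).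
    have : (3 * n%:R + L) * eps k <= E%:R * eps k by apply: ler_wpM2r => //; exact: ltW.
    rewrite mulrDl -mulrA; lra.
  rewrite edist_natpt ?mulr_ge0 ?(ltW (eps0 k)) // /eps divfK ?gt_eqF //.
  by rewrite -natrX ler_nat.
- rewrite /direction_test !hs; try by case: (beta); rewrite ?mul0n ?mul1n.
  have b1 (b : bool) : (b * 2 ^ k)%:R / 2 ^+ k = b%:R :> R.
    by rewrite natrM natrX mulfK ?gt_eqF.
  have -> : (1 - beta)%N = ~~ beta by case: (beta).
  rewrite !b1; apply: le_truncn; rewrite ler_pM2r // lerD2r; exact: ltW.
Qed.

(** The summand 4 pays for the excess of [lengthpt], [E] for the tolerance of the tests and [2 * n]
    for the error of the samples. *)
Let C : R := 4 + E%:R + 2 * n%:R.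

Lemma candidate_lip k s i j : cand k s -> (i <= 2 ^ k)%N -> (j <= 2 ^ k)%N ->
  edist (gv k s i) (gv k s j) <= L * `|i%:R / 2 ^+ k - j%:R / 2 ^+ k| + C * eps k.
Proof.
move=> /and3P [/lip_testP h _ _] ik jk; apply: le_trans (h i j ik jk) _.
have /andP [_ l2] := lengthpt_bounds k.
set d := `|_|; have d0 : 0 <= d by exact: normr_ge0.
have d1 : d <= 1.
  have P0 := pow0 k.
  have u01 m : (m <= 2 ^ k)%N -> 0 <= (m%:R / 2 ^+ k : R) <= 1.
    move=> mk; rewrite divr_ge0 ?(ltW P0) //=.
    by rewrite ler_pdivrMr // mul1r -natrX ler_nat.
  have := u01 i ik; have := u01 j jk; rewrite /d ler_norml; lra.
have : (lengthpt ol k)%:R / 2 ^+ k * d <= (L + 4 * eps k) * d by apply: ler_wpM2r.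
have : 4 * eps k * d <= 4 * eps k * 1 by apply: ler_wpM2l => //; rewrite mulr_ge0 // ltW.
have : 0 <= n%:R * eps k by rewrite mulr_ge0 // ltW.
have -> : C * eps k = 4 * eps k + E%:R * eps k + 2 * (n%:R * eps k).
  by rewrite /C; ring.
lra.
Qed.

Lemma candidate_cover k s b m : cand k s -> (m < k)%N -> (b < 2 ^ m)%N ->
  exists2 i, (i <= 2 ^ k)%N & edist (gv k s i) (y b m) <= C * eps k.
Proof.
move=> /and3P [_ h _] mk bm.
have /forallP/(_ (Ordinal bm)) := forallP h (Ordinal mk).
move=> /existsP [i /= hi]; exists i; first by rewrite -ltnS ltn_ord.
have := samplept_close k b m; set z := natpt A k _ => hz.
have : edist (gv k s i) z <= E%:R * eps k.
  rewrite edist_natpt ?mulr_ge0 ?(ltW (eps0 k)) // /eps divfK ?gt_eqF //.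
  by rewrite -natrX ler_nat.
have := edist_triangle z (gv k s i) (y b m).
have -> : C * eps k = 4 * eps k + E%:R * eps k + n%:R * (2 * eps k).
  by rewrite /C; ring.
by have := eps0 k; lra.
Qed.

(** The limit theorem speaks of the grid point just below [tau], the machine evaluates at [gridpt].
    The two are within two mesh widths, and the Lipschitz test controls the difference. *)
Lemma candidates_converge (s : nat -> nat) K U w e :
  (forall k, (K <= k)%N -> cand k (s k)) ->
  UltraFilter U -> (forall N, U [set k | (N <= k)%N]) -> 0 < e ->
  U [set k | edist (gv k (s k) (gridpt k w)) (g (clamp01 (ratr (decq w)))) <= e].
Proof.
move=> hs UU Uoo e0; set tau := clamp01 _; have tau01 := clamp01_itv (ratr (decq w) : R).
pose Q := [set x | exists b m, (b < 2 ^ m)%N /\ x = y b m].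
have e2 : 0 < e / 2 by lra.
have A0 : (0 < A)%N.
  by have := g_bounded 0 c0; have := normr_ge0 (g 0 ord0 c0);
    rewrite -(ltr_nat R); lra.
have conv : U [set k | edist (gv k (s k) (Num.trunc (tau * 2 ^+ k))) (g tau) <= e / 2].
  apply: (@grid_converges R n g L cg inj_g len_g g_clamp c0 beta dir_g Q _
    (fun k i => gv k (s k) i) A%:R C K _ _ _ _ U UU Uoo tau (e / 2) tau01 e2).
  - move=> x d gx d0; have [b [m [bm h]]] := y_dense gx d0.
    by exists (y b m) => //; exists b, m.
  - by move=> k i c; exact: gridval_bounded.
  - by move=> k i j Kk ik jk; apply: candidate_lip => //; exact: hs.
  - move=> _ [b [m [bm ->]]]; exists (maxn K m.+1) => k; rewrite geq_max => /andP [Kk mk].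
    exact: candidate_cover (hs k Kk) mk bm.
  - move=> k Kk; have /and3P [_ _] := hs k Kk; rewrite /direction_test.
    have -> : (1 - beta)%N = ~~ beta by case: (beta).
    by move=> h; rewrite !mxE lerD2r ler_pM2r ?invr_gt0 // ler_nat.
apply: filterS (filterI (filterI conv (U_small UU Uoo (2 * L + C) e2)) (Uoo K)).
move=> k /= [[k1 k2] Kk]; have [i1 i2] := gridpt_close (R := R) k w.
have [j1 j2] := grid_floor k tau01.
have := edist_triangle (gv k (s k) (Num.trunc (tau * 2 ^+ k)))
  (gv k (s k) (gridpt k w)) (g tau).
have := candidate_lip (hs k Kk) i1 j1.
move: i2 j2 k2; rewrite -/tau -/(eps k); set a := _ / _; set b := _ / _ ^+ _ => i2 j2 k2.
have : L * `|a - b| <= L * (2 * eps k).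
  apply: ler_wpM2l; first exact: ltW.
  by move: i2 j2; rewrite !ler_norml; lra.
have e3 : (2 * L + C) * eps k = L * (2 * eps k) + C * eps k by ring.
by rewrite e3 in k2; lra.
Qed.

(** Otherwise two sequences of candidates stay more than [2^-r] apart near [w], although both have
    the same limit along an ultrafilter that contains all tails. *)
Lemma agreement_exists r w : exists k, agreement A E beta c0 ol P k r w.
Proof.
apply: contrapT => none.
have /choice [s hs] : forall k, exists s : nat * nat, (r <= k)%N ->
    [/\ cand k s.1, cand k s.2 &
      eps r < edist (gv k s.1 (gridpt k w)) (gv k s.2 (gridpt k w))].
  move=> k; have [rk|_] := leqP r k; last by exists (0, 0)%N.
  have : ~~ agreement A E beta c0 ol P k r w by apply/negP => h; apply: none; exists k.
  rewrite /agreement rk /= negb_forall => /existsP [s1].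
  rewrite negb_forall => /existsP [s2]; rewrite !negb_imply => /and3P [h1 h2 h3].
  exists (s1 : nat, s2 : nat) => _; split => //.
  rewrite ltNge; apply: contra h3; rewrite edist_gridval; last exact: ltW.
  rewrite exprMn mulrC -ler_pdivrMr ?exprn_gt0 //.
  rewrite exprVn invrK mulrC -!exprM -(mulnC 2) (exprM _ 2 r) (mulnC k) exprM.
  have -> : 2 ^+ 2 = 4%:R :> R by rewrite -natrX.
  by rewrite -!natrX -natrM ler_nat.
have [U [UU subU]] := ultraFilterLemma eventually_filter.
have Uoo N : U [set k | (N <= k)%N] by apply: subU; exists N.
have e2 : 0 < eps r / 2 by rewrite divr_gt0.
have h1 k : (r <= k)%N -> cand k (s k).1 by move=> /hs [].
have h2 k : (r <= k)%N -> cand k (s k).2 by move=> /hs [].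
have [k [[k1 k2] rk]] := filter_ex (filterI (filterI
  (candidates_converge w h1 UU Uoo e2) (candidates_converge w h2 UU Uoo e2)) (Uoo r)).
have [_ _] := hs k rk.
have := edist_triangle (g (clamp01 (ratr (decq w))))
  (gv k (s k).1 (gridpt k w)) (gv k (s k).2 (gridpt k w)).
rewrite (edistC (g _)); move: k1 k2 => /=; lra.
Qed.

(** Agreement ranges over codes below [code_bound], but the machine searches for [s] without a
    bound. Minimality puts [s] below the code of the rounding of [g], hence within range, and the
    two may be compared. *)
Lemma agreement_accurate k r w s : agreement A E beta c0 ol P k r w -> cand k s ->
  (forall s', (s' < s)%N -> ~~ cand k s') ->
  edist (gv k s (gridpt k w)) (g (ratr (decq w))) <= (1 + n%:R + L) * eps r.
Proof.
move=> /andP [rk /forallP h] cs smin.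
have [s0 s0b [cs0 hs0]] := candidate_exists k.
have ss0 : (s <= s0)%N by rewrite leqNgt; apply/negP => /smin; rewrite cs0.
have sb := leq_ltn_trans ss0 s0b.
have /forallP/(_ (Ordinal s0b)) := h (Ordinal sb).
rewrite [candidate _ _ _ _ _ _ _ _]cs [candidate _ _ _ _ _ _ _ _]cs0 /= => hd.
have dss0 : edist (gv k s (gridpt k w)) (gv k s0 (gridpt k w)) <= eps r.
  rewrite edist_gridval; last exact: ltW.
  rewrite exprMn mulrC -ler_pdivrMr ?exprn_gt0 //.
  rewrite exprVn invrK mulrC -!exprM -(mulnC 2) (exprM _ 2 r) (mulnC k) exprM.
  have -> : 2 ^+ 2 = 4%:R :> R by rewrite -natrX.
  by rewrite -!natrX -natrM ler_nat.
have [i1 i2] := gridpt_close (R := R) k w.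
have ekr : eps k <= eps r.
  by rewrite /eps lef_pV2 ?posrE ?exprn_gt0 // ler_eXn2l // ltr1n.
have d1 := hs0 _ i1.
have d2 := lip_g ((gridpt k w)%:R / 2 ^+ k) (clamp01 (ratr (decq w))).
have d3 : L * `|(gridpt k w)%:R / 2 ^+ k - clamp01 (ratr (decq w))| <= L * eps r.
  by apply: ler_wpM2l; [exact: ltW|exact: le_trans ekr].
have d4 : n%:R * eps k <= n%:R * eps r by apply: ler_wpM2l.
have := edist_triangle (gv k s0 (gridpt k w)) (gv k s (gridpt k w))
  (g (ratr (decq w))).
have := edist_triangle (g ((gridpt k w)%:R / 2 ^+ k)) (gv k s0 (gridpt k w))
  (g (ratr (decq w))).
rewrite g_clamp in d2 d3 *.
have -> : (1 + n%:R + L) * eps r = eps r + n%:R * eps r + L * eps r by ring.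
lra.
Qed.

End Search.

(** * Decoding of the output *)

Section Output.
Context {R : realType}.

Lemma decq_out_coord n A k s i c :
  ratr (decq (out_coord n A k s i c)) = (digit n A k s i c)%:R / 2 ^+ k - A%:R :> R.
Proof.
have P0 : 2 ^+ k != 0 :> R by rewrite expf_neq0 // pnatr_eq0.
rewrite /out_coord /decq nunpairK /= prednK ?expn_gt0 //; set v := digit _ _ _ _ _ _.
rewrite fmorph_div /= ratr_int ratr_nat natrX /unzig.
have [le|lt] := leqP (A * 2 ^ k) v.
  by rewrite odd_double doubleK -pmulrn natrB // natrM natrX mulrBl mulfK.
have [d dE] : exists d, (A * 2 ^ k - v = d.+1)%N by exists (A * 2 ^ k - v).-1; lia.
rewrite dE doubleS /= odd_double /= doubleK.
have -> : d.+1%:Z = (A * 2 ^ k - v)%N%:Z by rewrite dE.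
rewrite mulrNz -pmulrn natrB ?(ltnW lt) // natrM natrX mulNr mulrBl mulfK //.
by rewrite opprB.
Qed.

Lemma decseq_npair m a b : decseq m.+1 (npair a b) = a :: decseq m b.
Proof.
rewrite -[LHS]/((nunpair (npair a b)).1 :: decseq m (nunpair (npair a b)).2).
by rewrite nunpairK.
Qed.

Lemma nth_out_seq n A m c k s i j : (j < m)%N ->
  nth 0%N (decseq m (out_seq n A m c k s i)) j = out_coord n A k s i (c + j).
Proof.
elim: m c j => [//|m IH] c j; rewrite [out_seq _ _ _ _ _ _ _]/= decseq_npair.
by case: j => [_|j jm]; rewrite ?addn0 // -addSnnS -IH.
Qed.

Lemma decpt_out_seq n A k s i :
  map_mx ratr (decpt n (out_seq n A n 0 k s i)) = gridval A k s i :> 'rV[R]_n.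
Proof.
by apply/rowP => c; rewrite !mxE nth_out_seq // decq_out_coord.
Qed.

End Output.

Unset Implicit Arguments.

Theorem theorem5p1 (R : realType) (n : nat) (gstar : R -> 'rV[R]_n)
  (Ol : nat -> rat) (gamma : R -> 'rV[R]_n) :
  computable gstar ->
  simple_curve (gstar @` `[0, 1]%classic) ->
  rectifiable (gstar @` `[0, 1]%classic) ->
  is_oracle (fine (H1 (gstar @` `[0, 1]%classic))) Ol ->
  normalized_cs_param (gstar @` `[0, 1]%classic) gamma ->
  computable_with [:: Ol] gamma.
Proof.
set Gam := gstar @` _; move=> cstar _ rect; set L := fine _ => oL [cgam injgam imgam lengam].
have HL : H1 Gam = L%:E by rewrite fineK // ge0_fin_numE // H1_ge0.
pose g := gamma \o clamp01.
have cg : continuous g by exact: continuous_extension01.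
have inj_g s t : 0 <= s <= 1 -> 0 <= t <= 1 -> g s = g t -> s = t.
  move=> hs ht; rewrite /g /= !clamp01_id //.
  by apply: injgam; rewrite inE /= in_itv.
have len_g t : 0 <= t <= 1 -> H1 (g @` `[0, t]) = (t * L)%:E.
  move=> t01; rewrite image_extension01 //; last by case/andP: t01.
  by rewrite lengam // HL EFinM.
have g_clamp t : g (clamp01 t) = g t by rewrite /g /= (clamp01_id (clamp01_itv t)).
have img : g @` `[0, 1] = Gam by rewrite image_extension01.
have L0 := arclength_gt0 cg inj_g len_g.
have lip_g := arclength_lipschitz cg inj_g len_g g_clamp.
(* The end points differ by injectivity, hence in some coordinate. The choice is not effective, but
   it is made once for the curve. *)
have [c0 [beta dir_g]] : exists (c0 : 'I_n) (beta : bool),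
    g beta%:R ord0 c0 < g (~~ beta)%:R ord0 c0.
  have [c hc] : exists c, g 0 ord0 c != g 1 ord0 c.
    apply: contrapT => same; have : (0 : R) = 1.
      apply: inj_g; rewrite ?lexx ?ler01 //; apply/rowP => c.
      by apply: contrapT => /eqP ne; apply: same; exists c.
    by move=> /esym/eqP; rewrite oner_eq0.
  exists c; have [lt|gt|e] := ltgtP (g 0 ord0 c) (g 1 ord0 c).
  - by exists false.
  - by exists true.
  - by rewrite e eqxx in hc.
have [A g_bounded] : exists A : nat, forall t c, `|g t ord0 c| + 1 <= A%:R.
  exists (Num.trunc (\sum_c `|g 0 ord0 c| + L + 1)).+1 => t c.
  apply: le_trans (ltW (truncnS_gt _)); rewrite lerD2r.
  have h1 : `|g 0 ord0 c| <= \sum_c `|g 0 ord0 c|.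
    by rewrite (bigD1 c) //= lerDl sumr_ge0.
  have h2 : edist (g t) (g 0) <= L.
    rewrite -(g_clamp t); apply: le_trans (lip_g _ _) _.
    rewrite subr0 -[leRHS]mulr1; apply: ler_wpM2l; first exact: ltW.
    by have := clamp01_itv t; rewrite ler_norml; lra.
  have := coord_le_edist (g t) (g 0) c; have := ler_normD (g t ord0 c - g 0 ord0 c) (g 0 ord0 c).
  by rewrite subrK; lra.
pose E := (Num.trunc (3 * n%:R + L)).+1.
have E_large : 3 * n%:R + L <= E%:R by exact: ltW (truncnS_gt _).
have [P [recP hP]] := computable_sample cstar (encq \o Ol).
pose y b m : 'rV[R]_n := gstar (ratr (sample b m)).
have hP' b m r : edist (map_mx ratr (decpt n (P b m r))) (y b m) <= (2 ^+ r)^-1.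
  exact: hP.
have y_g b m : (g @` `[0, 1]) (y b m).
  by rewrite img; exists (ratr (sample b m)) => //; rewrite /= in_itv; exact: sample_itv.
have y_dense x e : (g @` `[0, 1]) x -> 0 < e ->
    exists b m, (b < 2 ^ m)%N /\ edist (y b m) x <= e.
  rewrite img => -[t + <-]; rewrite /= in_itv /= => t01 e0.
  exact: computable_sample_dense.
(* In units of [2^-(r + D)] the candidate is off by at most [1 + n + L] at the rational coded by
   [w], and replacing [t] by that rational costs another [L]. *)
have [D hD] := exp2_inv_small (1 + n%:R + 2 * L) (@ltr01 R).
have [M hM] := search_code A E beta c0 recP D.
exists M => t t01 Ot oOt r; rewrite /outputs_approx /=.
set w := encq (Ot (r + D)%N).
have ex_agree := agreement_exists cg inj_g len_g g_clamp dir_g oL E g_bounded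
  hP' y_g y_dense (r + D) w.
case: (ex_minnP ex_agree) => k hk kmin.
have [s0 _ [cs0 _]] := candidate_exists cg inj_g len_g g_clamp dir_g oL g_bounded
  E_large hP' y_g k.
case: (ex_minnP (ex_intro _ s0 cs0)) => s hs smin.
have smin' s' : (s' < s)%N -> ~~ candidate A E beta c0 (encq \o Ol) P k s'.
  by move=> lt; apply/negP => /smin; rewrite leqNgt lt.
exists (out_seq n A n 0 k s (gridpt k w)); split.
  apply: (hM (encq \o Ot)) => // k' lt.
  by apply/negP => /kmin; rewrite leqNgt lt.
rewrite decpt_out_seq.
have d1 := agreement_accurate cg inj_g len_g g_clamp dir_g oL g_bounded E_large
  hP' y_g hk hs smin'.
have d2 : edist (g (ratr (decq w))) (gamma t) <= L * (2 ^+ (r + D))^-1.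
  have -> : gamma t = g t by rewrite /g /= clamp01_id.
  apply: le_trans (lip_g _ _) _; apply: ler_wpM2l; first exact: ltW.
  by rewrite /w encqK; exact: oOt.
apply: le_trans (edist_triangle (g (ratr (decq w))) _ _) _.
apply: le_trans (lerD d1 d2) _.
rewrite -mulrDl exprD invfM mulrCA.
rewrite -[leRHS]mulr1; apply: ler_wpM2l; first by rewrite invr_ge0 exprn_ge0.
have := hD D (leqnn D); set e := (_ ^-1).
by have -> : 1 + n%:R + 2 * L = 1 + n%:R + L + L by ring.
Qed.
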